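(* There exists a robot (finite automaton with a generator of random bits) with one stone and no flags ($n=1$, $M=\varnothing$) that covers $\mathbb{Z}^4$, and there is no robot with one stone and no flags that covers $\mathbb{Z}^5$.
   Context: Fix $k\ge 1$, let $G=\mathbb{Z}^k$ (with neutral element $0$), let $D=\{e_1,-e_1,\dots,e_k,-e_k\}$ where $e_1,\dots,e_k$ is the standard basis, let $n\ge 0$ be an integer (the number of stones) and let $M\subseteq G$ (the set of flagged cells). Elements of $G$ are called cells. A robot (finite automaton with a generator of random bits) with $n$ stones consists of a finite set $Q$ of states, an initial state $q_0\in Q$, a transition function $\delta: Q\times\{0,1\}^{n+2}\to Q$, and, for each $q\in Q$, a move $(d(q),p(q))\in D\times\{0,1\}^n$. The random bits $\xi_1,\xi_2,\dots$ are independent with $P(\xi_i=0)=P(\xi_i=1)=\tfrac12$. A configuration is a tuple $(a,s_1,\dots,s_n,t,q)$ with $a\in G$ (position of the robot), $s_i\in G$ (positions of the stones), $t\in\mathbb{N}$ (number of the step) and $q\in Q$. The initial configuration is $(0,0,\dots,0,1,q_0)$, so the robot and all stones start at $0$. From $(a,s_1,\dots,s_n,t,q)$ with $(d,p)=(d(q),p(q))$ the system passes to $(a',s_1',\dots,s_n',t+1,q')$, where $a'=a+d$; $s_i'=s_i+d$ if the $i$-th bit of $p$ is $1$ and $s_i=a$, and $s_i'=s_i$ otherwise; and $q'=\delta(q,w)$, where $w\in\{0,1\}^{n+2}$ is the vector whose $i$-th bit ($1\le i\le n$) is $1$ if and only if $s_i=a$, whose $(n+1)$-st bit is $1$ if and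 only if $a\in M$, and whose $(n+2)$-nd bit is $\xi_t$. The robot covers $G$ if for every cell $x\in G$ the probability that the robot is at $x$ at some step equals $1$. *)

(* Defs.v *)
From mathcomp Require Import all_boot all_order all_algebra.
From mathcomp Require Import all_classical all_reals all_analysis.

Set Implicit Arguments.
Unset Strict Implicit.
Unset Printing Implicit Defensive.

Import GRing.Theory.

Local Open Scope classical_set_scope.
Local Open Scope ring_scope.

Notation cell k := 'rV[int]_k.

Definition unit_cell (k : nat) (i : 'I_k) : cell k := delta_mx ord0 i.

Definition is_direction (k : nat) (v : cell k) : bool :=
  [exists i : 'I_k, (v == unit_cell i) || (v == - unit_cell i)].

Record robot (k n : nat) := Robot {
  state : finType;
  init_state : state;
  trans : state -> (n + 2).-tuple bool -> state;
  move : state -> cell k;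
  carry : state -> n.-tuple bool;
  move_direction : forall q, is_direction (move q)
}.

Record config (k n : nat) (Q : Type) := Config {
  robot_pos : cell k;
  stone_pos : n.-tuple (cell k);
  step_number : nat;
  cur_state : Q
}.

Definition init_config (k n : nat) (r : robot k n) : config k n (state r) :=
  Config 0 [tuple 0 | i < n] 1 (init_state r).

Definition observation (k n : nat) (M : set (cell k)) (a : cell k)
    (s : n.-tuple (cell k)) (b : bool) : (n + 2).-tuple bool :=
  cat_tuple [tuple tnth s i == a | i < n] [tuple a \in M; b].

(* The random bits are numbered from 1 whereas [bits] is indexed from 0:
   [bits j] is the (j + 1)-st random bit, so step t uses [bits t.-1]. *)
Definition step (k n : nat) (r : robot k n) (M : set (cell k))
    (bits : nat -> bool) (c : config k n (state r)) : config k n (state r) :=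
  let: Config a s t q := c in
  let d := move q in
  Config (a + d)
         [tuple if tnth (carry q) i && (tnth s i == a)
                then tnth s i + d else tnth s i | i < n]
         t.+1
         (trans q (observation M a s (bits t.-1))).

(* The configuration after m transitions; its step number is m.+1. *)
Definition run (k n : nat) (r : robot k n) (M : set (cell k))
    (bits : nat -> bool) (m : nat) : config k n (state r) :=
  iter m (step M bits) (init_config r).

Definition visits (k n : nat) (r : robot k n) (M : set (cell k))
    (bits : nat -> bool) (x : cell k) : Prop :=
  exists m : nat, robot_pos (run r M bits m) = x.

Definition mutually_independent (R : realType) (d : measure_display)
    (T : measurableType d) (P : probability T R)
    (xi : nat -> {RV P >-> bool}) : Prop :=
  forall (J : seq nat) (B : nat -> set bool), uniq J ->
    P (\bigcap_(j in [set` J]) (xi j @^-1` B j)) =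
    (\prod_(j <- J) P (xi j @^-1` B j))%E.

Definition fair_bits (R : realType) (d : measure_display)
    (T : measurableType d) (P : probability T R)
    (xi : nat -> {RV P >-> bool}) : Prop :=
  (forall (j : nat) (b : bool), P (xi j @^-1` [set b]) = (2^-1 : R)%:E) /\
  mutually_independent xi.

(* Covering depends only on the law of the random bits, so the probability
   space carrying them is left arbitrary. *)
Definition covers (R : realType) (k n : nat) (r : robot k n)
    (M : set (cell k)) : Prop :=
  forall (d : measure_display) (T : measurableType d) (P : probability T R)
         (xi : nat -> {RV P >-> bool}), fair_bits xi ->
  forall x : cell k, P [set w | visits r M (fun j => xi j w) x] = 1%E.

(* Main.v *)
Require Import Defs.
From HB Require Import structures.
From mathcomp Require Import all_boot all_order all_algebra.
From mathcomp Require Import all_classical all_reals all_analysis.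
From mathcomp Require Import measurable_realfun.
From mathcomp Require Import ring lra zify.

Set Implicit Arguments.
Unset Strict Implicit.
Unset Printing Implicit Defensive.

Import Order.TTheory GRing.Theory Num.Theory.
Import numFieldNormedType.Exports.

(** Relative to the stone, an automaton that is to find the stone again with
    probability 1 has to be recurrent, hence its excursions stay near finitely
    many planes; between meetings the stone performs an automaton-driven walk.

    In Z^4 the robot carries the stone by a simple random walk along the first
    two axes and, between the steps of the stone, performs a simple random walk
    along the last two axes until it is back at the stone.  Both walks are
    recurrent, so the stone is in the plane of a given cell infinitely often, and
    each time the cell is visited with the same positive probability.

    In Z^5 a cell [x] is visited only if the stone is near one of the planes
    [x + V], with finitely many 2-dimensional [V].  In the quotient by [V], which
    has dimension at least 3, the walk of the stone either stays close to a
    proper subspace or is transient; so a generic [x] is missed with positive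
    probability.

    Probabilities are handled through harmonic functions: upper bounds for hitting
    probabilities come from superharmonic functions.  Transience of a walk with
    three independent loops comes from the bound [(n + 1) ^ (- 3 / 2)] for the
    concentration of a sum of [n] random choices of loops, applied to the lazy
    walk, which removes drifts and periodicities. *)

(** The dimension count is 5 = 2 + 2 + 1: one plane absorbs the excursions of the robot, another one
    a recurrent stone, and one coordinate is left in which a cell can be far away. The states of an
    automaton need not form an irreducible chain, so every potential is built for one strongly
    connected component. Away from the stone this is the component of a minimal state in which the
    stone may be lost; leaving it only makes the return certain. For the stone it is a closed class
    of the states at meetings. After projection along the planes, a cell corresponds to finitely
    many positions of the stone, so a union bound suffices once the potentials are small uniformly
    over all far targets. A step supplies a single random bit, enough for a sign but not for an
    axis, so the robot in Z^4 alternates axes, and parity classes have to be tracked. *)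

Local Open Scope classical_set_scope.
Local Open Scope ring_scope.

(** * Chains driven by fair bits *)

Section RandomBitChain.
Context {R : realType} {X : Type} (stp : X -> bool -> X).

Definition avg (f : X -> R) (c : X) : R := (f (stp c false) + f (stp c true)) / 2.

Lemma avg_le (f g : X -> R) c : (forall b, f (stp c b) <= g (stp c b)) ->
  avg f c <= avg g c.
Proof. by move=> fg; rewrite /avg ler_pM2r// lerD. Qed.

Section Value.
Variables (S : pred X) (f : X -> R).

(* The expectation of [f] at the first visit to [S], restricted to the event
   that this visit occurs within [n] steps. *)
Fixpoint val (n : nat) (c : X) : R :=
  if S c then f c else if n is n'.+1 then avg (val n') c else 0.

Definition vlim (c : X) : R := sup (range (val ^~ c)).

Hypothesis f01 : forall c, 0 <= f c <= 1.

Lemma val_ge0 n c : 0 <= val n c.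
Proof.
elim: n c => [|n IH] c /=; case: ifP => // _; try by case/andP: (f01 c).
by rewrite divr_ge0// addr_ge0.
Qed.

Lemma val_le1 n c : val n c <= 1.
Proof.
elim: n c => [|n IH] c /=; case: ifP => // _; try by case/andP: (f01 c).
by rewrite ler_pdivrMr// mul1r lerD.
Qed.

Lemma val_nondecreasing c : {homo val ^~ c : n m / (n <= m)%N >-> n <= m}.
Proof.
apply: homo_leq => [//|x y z|]; first exact: le_trans.
move=> n; elim: n c => [|n IH] c /=; case: ifP => // _; last exact: avg_le.
by rewrite divr_ge0// addr_ge0//; exact: (val_ge0 0).
Qed.

Lemma val_cvg c : val ^~ c @ \oo --> vlim c.
Proof.
apply: nondecreasing_cvgn; first exact: val_nondecreasing.
by exists 1 => _ [n _ <-]; exact: val_le1.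
Qed.

Lemma val_le_vlim n c : val n c <= vlim c.
Proof.
apply: ub_le_sup; last by exists n.
by exists 1 => _ [m _ <-]; exact: val_le1.
Qed.

Lemma vlim_le_ub c M : (forall n, val n c <= M) -> vlim c <= M.
Proof. by move=> h; apply: ge_sup => [|_ [n _ <-]//]; exists (val 0 c), 0%N. Qed.

Lemma vlim_ge0 c : 0 <= vlim c.
Proof. by apply: le_trans (val_le_vlim 0 c); exact: val_ge0. Qed.

Lemma vlim_le1 c : vlim c <= 1.
Proof. by apply: vlim_le_ub => n; exact: val_le1. Qed.

Lemma vlim_stop c : S c -> vlim c = f c.
Proof.
move=> Sc; apply/eqP; rewrite eq_le; apply/andP; split.
  by apply: vlim_le_ub => -[|n] /=; rewrite Sc.
by apply: le_trans (val_le_vlim 0 c); rewrite /= Sc.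
Qed.

Lemma vlim_step c : ~~ S c -> vlim c = avg vlim c.
Proof.
move=> /negbTE Sc.
have h1 : (fun n => val n.+1 c) @ \oo --> vlim c.
  by have := @val_cvg c; rewrite -(cvg_shiftS (val ^~ c)).
have h2 : (fun n => val n.+1 c) @ \oo --> avg vlim c.
  rewrite /avg; under eq_cvg do rewrite /= Sc.
  by apply: cvgMl; apply: cvgD; exact: val_cvg.
exact: (cvg_unique _ h1 h2).
Qed.

(** A nonnegative superharmonic majorant of [f] on [S] dominates every truncated expectation
    [val n], by induction on [n]. [Inv] restricts the hypotheses to the configurations that can
    actually occur. *)
Lemma vlim_comparison (Inv : X -> Prop) (H : X -> R) :
  (forall c, Inv c -> 0 <= H c) ->
  (forall c, Inv c -> S c -> f c <= H c) ->
  (forall c b, Inv c -> ~~ S c -> Inv (stp c b)) ->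
  (forall c, Inv c -> ~~ S c -> avg H c <= H c) ->
  forall c, Inv c -> vlim c <= H c.
Proof.
move=> H0 HS Istp HT c Ic; apply: vlim_le_ub => n.
elim: n c Ic => [|n IH] c Ic /=; case: ifPn => Sc; rewrite ?HS ?H0//.
by apply: le_trans (HT c Ic Sc); apply: avg_le => b; apply/IH/Istp.
Qed.

End Value.
End RandomBitChain.

(** * Concentration of random subsums *)

Lemma bin_half_max n k : ('C(n, k) <= 'C(n, n./2))%N.
Proof.
have incr m : (m.+1.*2 <= n.+1)%N -> ('C(n, m) <= 'C(n, m.+1))%N.
  move=> h; have mn : (m.+1 <= n)%N by lia.
  rewrite -(@leq_pmul2l m.+1)// mul_bin_left leq_mul2r; apply/orP; right; lia.
have low m j : (m + j <= n./2)%N -> ('C(n, m) <= 'C(n, m + j))%N.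
  elim: j => [|j IH] h; first by rewrite addn0.
  rewrite addnS; apply: leq_trans (incr _ _); first by apply: IH; lia.
  have := odd_double_half n; lia.
have half m : (m <= n./2)%N -> ('C(n, m) <= 'C(n, n./2))%N.
  by move=> h; rewrite -(subnKC h); apply: low; rewrite subnKC.
have [h|h] := leqP k n./2; first exact: half.
have [kn|kn] := leqP k n; last by rewrite bin_small.
rewrite -(@bin_sub n k)//; apply: half; have := odd_double_half n; lia.
Qed.

(** From [n] to [n.+1] the left side grows by the factor 4(2n+1)(2n+3)/(n+1)^2, which is below 16
    because (2n+1)(2n+3) = 4(n+1)^2 - 1. *)
Lemma central_bin_bound n : ('C(n.*2, n) ^ 2 * n.*2.+1 <= 16 ^ n)%N.
Proof.
elim: n => [//|n IH].
have e : (n.+1 * 'C(n.+1.*2, n.+1) = 2 * n.*2.+1 * 'C(n.*2, n))%N.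
  have h1 : (n.+1 * 'C(n.*2.+2, n.+1) = n.*2.+2 * 'C(n.*2.+1, n))%N.
    by rewrite -mul_bin_diag.
  have h2 : (n.+1 * 'C(n.*2.+1, n) = n.*2.+1 * 'C(n.*2, n))%N.
    have -> : ('C(n.*2.+1, n) = 'C(n.*2.+1, n.+1))%N.
      rewrite -(@bin_sub n.*2.+1 n); last by lia.
      by congr binomial; lia.
    by rewrite -mul_bin_diag.
  rewrite doubleS h1; have -> : n.*2.+2 = (2 * n.+1)%N by lia.
  by rewrite -mulnA h2 mulnA.
rewrite -(@leq_pmul2l (n.+1 ^ 2)) ?expn_gt0// mulnA -expnMn e.
have -> : ((2 * n.*2.+1 * 'C(n.*2, n)) ^ 2 * n.+1.*2.+1 =
  ('C(n.*2, n) ^ 2 * n.*2.+1) * (4 * (n.*2.+1 * n.+1.*2.+1)))%N.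
  by move: 'C(_, _) n.*2.+1 n.+1.*2.+1 => B d d'; ring.
have -> : (n.+1 ^ 2 * 16 ^ n.+1 = 16 ^ n * (16 * n.+1 ^ 2))%N.
  by rewrite (expnS 16); move: (16 ^ n)%N (n.+1 ^ 2)%N => u v; ring.
by apply: leq_mul => //; nia.
Qed.

Lemma bin_sqr_bound n k : ('C(n, k) ^ 2 * n.+1 <= 4 ^ n)%N.
Proof.
apply: (@leq_trans ('C(n, n./2) ^ 2 * n.+1)).
  by rewrite leq_mul2r leq_exp2r// bin_half_max.
have en := odd_double_half n; move: en; case: (odd n) => /= en; last first.
  have := central_bin_bound n./2; rewrite -[16%N]/(4 ^ 2)%N -expnM mul2n.
  by rewrite add0n in en; rewrite en.
(* For odd n = 2m+1 the even bound at 2m+2 is used: its central coefficient is twice C(2m+1, m), and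
   the square of this 2 is the surplus factor 4 of the power. *)
set m := n./2 in en *; rewrite -{}en add1n.
have := central_bin_bound m.+1; rewrite doubleS -[16%N]/(4 ^ 2)%N -expnM mul2n.
have -> : ('C(m.*2.+2, m.+1) = 2 * 'C(m.*2.+1, m))%N.
  rewrite binS; have -> : 'C(m.*2.+1, m.+1) = 'C(m.*2.+1, m); last by lia.
  rewrite -(@bin_sub m.*2.+1 m); last by lia.
  by congr binomial; lia.
rewrite expnMn -mulnA doubleS expnS leq_pmul2l//.
by apply: leq_trans; rewrite leq_mul2l; apply/orP; right; lia.
Qed.

Section HalfShift.
Context {R : realType} {V : zmodType}.

Definition half_shift (l : V) (f : V -> R) (x : V) : R := (f x + f (x + l)) / 2.

Lemma half_shiftC a b f :
  half_shift a (half_shift b f) = half_shift b (half_shift a f).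
Proof. by apply/funext => x; rewrite /half_shift (addrAC x a b); field. Qed.

Lemma half_shift_ge0 l f : (forall x, 0 <= f x) -> forall x, 0 <= half_shift l f x.
Proof. by move=> f0 x; rewrite divr_ge0// addr_ge0. Qed.

Lemma iter_half_shift_ge0 N l f : (forall x, 0 <= f x) ->
  forall x, 0 <= iter N (half_shift l) f x.
Proof. by move=> f0; elim: N => [//|N IH]; apply: half_shift_ge0. Qed.

Lemma iter_half_shift_supp N l f x : iter N (half_shift l) f x != 0 ->
  exists k, f (x + l *+ k) != 0.
Proof.
elim: N x => [|N IH] x /=; first by exists 0%N; rewrite mulr0n addr0.
rewrite {1}/half_shift; have [->|/IH//] := eqVneq (iter N (half_shift l) f x) 0.
have [->|/IH[k hk] _] := eqVneq (iter N (half_shift l) f (x + l)) 0.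
  by rewrite addr0 mul0r eqxx.
by exists k.+1; rewrite mulrS addrA.
Qed.

Lemma iter_half_shiftE N l f x :
  iter N (half_shift l) f x =
  \sum_(k < N.+1) 'C(N, k)%:R / 2 ^+ N * f (x + l *+ k).
Proof.
elim: N x => [|N IH] x.
  by rewrite big_ord_recl big_ord0 /= mulr0n !addr0 divr1 mul1r.
rewrite iterS {1}/half_shift !IH big_ord_recl [in RHS]big_ord_recl /=.
rewrite [in X in _ + _ + X]big_ord_recr /= !bin0 mulr0n !addr0.
rewrite [in RHS]big_ord_recr /= binn.
have e : forall i : 'I_N, (x + l + l *+ i) = x + l *+ bump 0 i.
  by move=> i; rewrite /bump leq0n add1n mulrS addrA.
have -> : \sum_(i < N) 'C(N.+1, bump 0 i)%:R / 2 ^+ N.+1 * f (x + l *+ bump 0 i)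
  = (\sum_(i < N) 'C(N, bump 0 i)%:R / 2 ^+ N * f (x + l *+ bump 0 i) +
     \sum_(i < N) 'C(N, i)%:R / 2 ^+ N * f (x + l + l *+ i)) / 2.
  rewrite -big_split mulr_suml /=; apply: eq_bigr => i _.
  rewrite e /bump leq0n add1n binS natrD exprS.
  by field; rewrite expf_neq0.
have -> : x + l *+ bump 0 N = x + l + l *+ N by rewrite /bump leq0n add1n mulrS addrA.
rewrite ?binn exprS.
by field; rewrite expf_neq0.
Qed.

(** A progression with difference [l] meets the support of [f] at most once, so a single binomial
    weight survives in the expansion, and [bin_sqr_bound] applies to it. *)
Lemma iter_half_shift_bound N l f M :
  (forall x, 0 <= f x <= M) ->
  (forall x (j k : nat), f (x + l *+ j) != 0 -> f (x + l *+ k) != 0 -> j = k) ->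
  forall x, iter N (half_shift l) f x <= M / Num.sqrt N.+1%:R.
Proof.
move=> fM f1 x; rewrite iter_half_shiftE.
have M0 : 0 <= M by case/andP: (fM x); exact: le_trans.
have s0 : 0 < Num.sqrt (N.+1%:R : R) by rewrite sqrtr_gt0.
have [[i fi]|none] := pselect (exists i : 'I_N.+1, f (x + l *+ i) != 0); last first.
  rewrite big1; first exact: divr_ge0 M0 (ltW s0).
  move=> i _.
  have [->|h] := eqVneq (f (x + l *+ i)) 0; first by rewrite mulr0.
  by case: none; exists i.
rewrite (bigD1 i)//= big1 ?addr0; last first.
  move=> j ji; have [->|h] := eqVneq (f (x + l *+ j)) 0; first by rewrite mulr0.
  by move: ji; rewrite -(inj_eq val_inj) /= (f1 _ _ _ fi h) eqxx.
rewrite [leRHS]mulrC; have /andP[f0 fle] := fM (x + l *+ i).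
apply: ler_pM => //.
rewrite ler_pdivrMr ?exprn_gt0// mulrC ler_pdivlMr//.
rewrite -(@ler_pXn2r _ 2)// ?nnegrE ?mulr_ge0 ?exprn_ge0 ?(ltW s0)//.
rewrite exprMn sqr_sqrtr// -exprM mulnC exprM.
rewrite -natrX -[2 ^+ 2]natrX -natrM -natrX ler_nat.
exact: bin_sqr_bound.
Qed.

Section Cube.
Variables l1 l2 l3 : V.
Hypothesis indep : forall a1 a2 a3 b1 b2 b3 : nat,
  l1 *+ a1 + l2 *+ a2 + l3 *+ a3 = l1 *+ b1 + l2 *+ b2 + l3 *+ b3 ->
  [/\ a1 = b1, a2 = b2 & a3 = b3].

Definition cube (f : V -> R) : V -> R :=
  half_shift l1 (half_shift l2 (half_shift l3 f)).

Lemma half_shift_iterC a b N f :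
  half_shift a (iter N (half_shift b) f) = iter N (half_shift b) (half_shift a f).
Proof. by elim: N f => [//|N IH] f; rewrite !iterS half_shiftC IH. Qed.

Lemma iter_cube N f : iter N cube f =
  iter N (half_shift l1) (iter N (half_shift l2) (iter N (half_shift l3) f)).
Proof.
elim: N => [//|N IH]; rewrite iterS IH /cube !iterS.
by rewrite (half_shift_iterC l3 l1) (half_shift_iterC l3 l2) (half_shift_iterC l2 l1).
Qed.

(** The commuting averages are applied one direction at a time, each gaining a factor (N+1)^(-1/2):
    by [indep], a progression in the next direction contains at most one point from which [z] is
    still attainable. *)
Lemma iter_cube_dirac_bound N z x :
  iter N cube (fun y => (y == z)%:R) x <= (Num.sqrt N.+1%:R ^+ 3)^-1.
Proof.
have s0 : 0 < Num.sqrt (N.+1%:R : R) by rewrite sqrtr_gt0.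
pose delta (y : V) : R := (y == z)%:R.
have d0 y : 0 <= delta y <= 1 by rewrite /delta; case: (_ == _); rewrite lexx ler01.
have supp3 y : iter N (half_shift l3) delta y != 0 ->
    exists k, y + l3 *+ k = z.
  by move=> /iter_half_shift_supp[k]; rewrite /delta; case: (_ =P z) => [<- _|_]; [exists k|rewrite eqxx].
have supp2 y : iter N (half_shift l2) (iter N (half_shift l3) delta) y != 0 ->
    exists j k, y + l2 *+ j + l3 *+ k = z.
  by move=> /iter_half_shift_supp[j /supp3[k <-]]; exists j, k.
have b3 y : 0 <= iter N (half_shift l3) delta y <= 1 / Num.sqrt N.+1%:R.
  apply/andP; split.
    by apply: iter_half_shift_ge0 => v; case/andP: (d0 v).
  apply: iter_half_shift_bound => // v j k; rewrite /delta.
  case: (_ =P z) => [e1 _|_]; last by rewrite eqxx.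
  case: (_ =P z) => [e2 _|_]; last by rewrite eqxx.
  have := @indep 0 0 j 0 0 k; case => //.
  by rewrite !mulr0n !add0r; apply: (@addrI _ v); rewrite e1 e2.
have b2 y : 0 <= iter N (half_shift l2) (iter N (half_shift l3) delta) y
    <= 1 / Num.sqrt N.+1%:R / Num.sqrt N.+1%:R.
  apply/andP; split.
    by apply: iter_half_shift_ge0 => v; case/andP: (b3 v).
  apply: iter_half_shift_bound => // v j k /supp3[j' ej] /supp3[k' ek].
  have := @indep 0 j j' 0 k k'; case => //.
  by rewrite !mulr0n !add0r; apply: (@addrI _ v); rewrite !addrA ej ek.
rewrite -/delta iter_cube; have -> : (Num.sqrt N.+1%:R ^+ 3)^-1 =
  1 / Num.sqrt N.+1%:R / Num.sqrt N.+1%:R / Num.sqrt N.+1%:R :> R.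
  by field; rewrite gt_eqF.
apply: iter_half_shift_bound => // v j k /supp2[j1 [j2 ej]] /supp2[k1 [k2 ek]].
have := @indep j j1 j2 k k1 k2; case => //.
by apply: (@addrI _ v); rewrite !addrA ej ek.
Qed.

End Cube.
End HalfShift.

(** * Transience of weighted walks *)

Section CubeGreen.
Context {R : realType}.

(* Telescoping majorant of the series of [(N + 1) ^ (- 3 / 2)]. *)
Definition cube_tail (N : nat) : R := 4 / Num.sqrt N.+1%:R.

(** With a^2 = N+1 and b^2 = N+2 the difference is 4/(ab(a+b)), and b(a+b) <= 4a^2 follows from 2ab
    <= a^2 + b^2 and 1 <= a^2. *)
Lemma cube_tail_diff N :
  (Num.sqrt N.+1%:R ^+ 3)^-1 <= cube_tail N - cube_tail N.+1.
Proof.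
rewrite /cube_tail; set a := Num.sqrt N.+1%:R; set b := Num.sqrt N.+2%:R.
have a2 : a ^+ 2 = N.+1%:R by rewrite sqr_sqrtr.
have b2 : b ^+ 2 = a ^+ 2 + 1 by rewrite sqr_sqrtr// a2 -natr1.
have a0 : 0 < a by rewrite sqrtr_gt0.
have b0 : 0 < b by rewrite sqrtr_gt0.
have a1 : 1 <= a ^+ 2 by rewrite a2 ler1n.
have ab : a * b <= 3 * a ^+ 2 - 1.
  have : 0 <= (a - b) ^+ 2 by exact: sqr_ge0.
  rewrite sqrrB b2; lra.
have -> : 4 / a - 4 / b = (4 * a ^+ 2) / ((a + b) * b) * (a ^+ 3)^-1.
  have -> : 4 / a - 4 / b = 4 * (b ^+ 2 - a ^+ 2) / ((a + b) * b * a).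
    by field; rewrite !gt_eqF// addr_gt0.
  by rewrite b2; field; rewrite !gt_eqF// addr_gt0.
apply: ler_peMl; first by rewrite invr_ge0 exprn_ge0// ltW.
rewrite ler_pdivlMr ?mulr_gt0 ?addr_gt0// mul1r.
rewrite mulrDl -expr2 b2; lra.
Qed.

Lemma cube_tail_ge0 N : 0 <= cube_tail N.
Proof. by rewrite divr_ge0// sqrtr_ge0. Qed.

(** The expectation of the increment of [cube_tail] at N + Y, where Y is binomial with [n] trials of
    success probability [p]: Y counts the blocks of steps that contributed a random choice of
    loops. *)
Fixpoint green_bd (p : R) (n N : nat) : R :=
  if n is n'.+1 then (1 - p) * green_bd p n' N + p * green_bd p n' N.+1
  else cube_tail N - cube_tail N.+1.

Lemma green_bd_ge0 p n N : 0 <= p <= 1 -> 0 <= green_bd p n N.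
Proof.
move=> /andP[p0 p1]; elim: n N => [|n IH] N /=.
  by apply: le_trans (cube_tail_diff N); rewrite invr_ge0 exprn_ge0// sqrtr_ge0.
by rewrite addr_ge0// mulr_ge0// subr_ge0.
Qed.

(** Each value of the count lasts 1/p trials on average, and the increments telescope. The induction
    conditions on the first trial. *)
Lemma green_bd_sum p n N : 0 < p <= 1 ->
  \sum_(i < n) green_bd p i N <= cube_tail N / p.
Proof.
move=> /andP[p0 p1]; elim: n N => [|n IH] N.
  by rewrite big_ord0 divr_ge0 ?cube_tail_ge0// ltW.
rewrite big_ord_recl /=.
have -> : \sum_(i < n) green_bd p (bump 0 i) N =
   (1 - p) * \sum_(i < n) green_bd p i N + p * \sum_(i < n) green_bd p i N.+1.
  by rewrite !mulr_sumr -big_split; apply: eq_bigr => i _; rewrite /bump leq0n add1n.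
have h1 : (1 - p) * \sum_(i < n) green_bd p i N <= (1 - p) * (cube_tail N / p).
  by rewrite ler_wpM2l// subr_ge0.
have h2 : p * \sum_(i < n) green_bd p i N.+1 <= cube_tail N.+1.
  by rewrite -ler_pdivlMl// mulrC.
have e : (1 - p) * (cube_tail N / p) = cube_tail N / p - cube_tail N.
  by field; rewrite gt_eqF.
lra.
Qed.

End CubeGreen.

(** * Lazy walks driven by a finite automaton, acting on functions *)

Section WeightedChain.
Context {R : realType} {K : finType} {V : zmodType}.
Variables (w : K -> K -> R) (disp : K -> V).
Hypothesis w_ge0 : forall q q', 0 <= w q q'.
Hypothesis w_le1 : forall q, \sum_q' w q q' <= 1.

Definition walk_op (F : K -> V -> R) (q : K) (x : V) : R :=
  \sum_q' w q q' * F q' (x + disp q).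

Definition lazy_op (F : K -> V -> R) (q : K) (x : V) : R :=
  (F q x + walk_op F q x) / 2.

Implicit Types F G : K -> V -> R.

Lemma walk_op_ge0 F : (forall q x, 0 <= F q x) -> forall q x, 0 <= walk_op F q x.
Proof. by move=> F0 q x; apply: sumr_ge0 => q' _; rewrite mulr_ge0. Qed.

Lemma walk_op_ub F M : 0 <= M -> (forall q x, F q x <= M) ->
  forall q x, walk_op F q x <= M.
Proof.
move=> M0 FM q x; apply: (@le_trans _ _ (\sum_q' w q q' * M)).
  by apply: ler_sum => q' _; rewrite ler_wpM2l.
by rewrite -mulr_suml ler_piMl.
Qed.

Lemma lazy_op_ge0 F : (forall q x, 0 <= F q x) -> forall q x, 0 <= lazy_op F q x.
Proof. by move=> F0 q x; rewrite divr_ge0// addr_ge0// walk_op_ge0. Qed.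

Lemma lazy_op_ub F M : 0 <= M -> (forall q x, F q x <= M) ->
  forall q x, lazy_op F q x <= M.
Proof.
by move=> M0 FM q x; rewrite ler_pdivrMr// mulr_natr mulr2n lerD// walk_op_ub.
Qed.

Lemma lazy_opB F G q x :
  lazy_op (fun q x => F q x - G q x) q x = lazy_op F q x - lazy_op G q x.
Proof.
rewrite /lazy_op /walk_op; under eq_bigr do rewrite mulrBr.
by rewrite sumrB; field.
Qed.

Lemma lazy_op_half_shift l F :
  lazy_op (fun q => half_shift l (F q)) = fun q => half_shift l (lazy_op F q).
Proof.
apply/funext => q; apply/funext => x; rewrite /half_shift /lazy_op /walk_op.
have -> : \sum_q' w q q' * ((F q' (x + disp q) + F q' (x + disp q + l)) / 2) =
   (\sum_q' w q q' * F q' (x + disp q) + \sum_q' w q q' * F q' (x + l + disp q)) / 2.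
  rewrite -big_split mulr_suml; apply: eq_bigr => q' _ /=.
  by rewrite (addrAC x l); field.
by field.
Qed.

Lemma lazy_op_cube l1 l2 l3 F :
  lazy_op (fun q => cube l1 l2 l3 (F q)) = fun q => cube l1 l2 l3 (lazy_op F q).
Proof. by rewrite /cube !lazy_op_half_shift. Qed.

Lemma iter_lazy_ge0 n F : (forall q x, 0 <= F q x) ->
  forall q x, 0 <= iter n lazy_op F q x.
Proof. by move=> F0; elim: n => [//|n IH]; apply: lazy_op_ge0. Qed.

Lemma iter_lazy_ub n F M : 0 <= M -> (forall q x, F q x <= M) ->
  forall q x, iter n lazy_op F q x <= M.
Proof. by move=> M0 FM; elim: n => [//|n IH]; apply: lazy_op_ub. Qed.

Lemma iter_lazyB n F G :
  iter n lazy_op (fun q x => F q x - G q x) =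
  fun q x => iter n lazy_op F q x - iter n lazy_op G q x.
Proof.
elim: n => [//|n IH]; rewrite !iterS IH.
by apply/funext => q; apply/funext => x; rewrite lazy_opB.
Qed.

Lemma iter_lazy_cube n l1 l2 l3 F :
  iter n lazy_op (fun q => cube l1 l2 l3 (F q)) =
  fun q => cube l1 l2 l3 (iter n lazy_op F q).
Proof. by elim: n => [//|n IH]; rewrite !iterS IH lazy_op_cube. Qed.

(** A lower bound [a] for the probability that [m] lazy steps lead from [q] to [q'] with
    displacement [v], expressed by testing on nonnegative functions. *)
Definition reach_lb (q q' : K) (v : V) (m : nat) (a : R) : Prop :=
  forall F, (forall q x, 0 <= F q x) ->
  forall x, a * F q' (x + v) <= iter m lazy_op F q x.

Definition reaches (q q' : K) (v : V) : Prop :=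
  exists m a, 0 < a /\ reach_lb q q' v m a.

Lemma reach_lb_le q q' v m a a' : a' <= a -> reach_lb q q' v m a ->
  reach_lb q q' v m a'.
Proof. by move=> aa h F F0 x; apply: le_trans (h F F0 x); rewrite ler_wpM2r. Qed.

(** Waiting [k] steps costs 2^-k. This brings paths of different lengths to a common time. *)
Lemma reach_lb_add q q' v m k a : reach_lb q q' v m a ->
  reach_lb q q' v (k + m) (a / 2 ^+ k).
Proof.
move=> h; elim: k => [|k IH] F F0 x; first by rewrite divr1; exact: h.
rewrite addSn iterS exprS invfM mulrA (mulrAC a) -mulrA mulrC mulrCA.
have := IH F F0 x; rewrite /lazy_op => IHx.
have : 0 <= walk_op (iter (k + m) lazy_op F) q x.
  by apply: walk_op_ge0; exact: iter_lazy_ge0.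
lra.
Qed.

Lemma reaches_refl q : reaches q q 0.
Proof. by exists 0%N, 1; split=> // F F0 x; rewrite mul1r addr0. Qed.

Lemma reaches_trans q q1 q2 v1 v2 :
  reaches q q1 v1 -> reaches q1 q2 v2 -> reaches q q2 (v1 + v2).
Proof.
move=> [m1 [a1 [a10 h1]]] [m2 [a2 [a20 h2]]]; exists (m1 + m2)%N, (a1 * a2).
split=> [|F F0 x]; first exact: mulr_gt0.
have H : a1 * iter m2 lazy_op F q1 (x + v1) <= iter (m1 + m2) lazy_op F q x.
  by rewrite iterD; apply: h1; exact: iter_lazy_ge0.
apply: le_trans H.
by rewrite -mulrA ler_pM2l// addrA h2.
Qed.

Lemma reaches_step q q' : 0 < w q q' -> reaches q q' (disp q).
Proof.
move=> w0; exists 1%N, (w q q' / 2); split=> [|F F0 x]; first exact: divr_gt0.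
rewrite /= /lazy_op /walk_op (bigD1 q')//= mulrAC ler_pM2r//.
by rewrite addrCA lerDl addr_ge0// sumr_ge0// => j _; rewrite mulr_ge0.
Qed.

Lemma reaches_uniform (I : finType) (f g : I -> K) (v : I -> V) :
  (forall i, reaches (f i) (g i) (v i)) ->
  exists m a, 0 < a /\ forall i, reach_lb (f i) (g i) (v i) m a.
Proof.
move=> h; suff [m [a [a0 hs]]] : exists m a, 0 < a /\
    forall i, i \in enum I -> reach_lb (f i) (g i) (v i) m a.
  by exists m, a; split=> // i; apply: hs; rewrite mem_enum.
elim: (enum I) => [|i s [m [a [a0 hs]]]]; first by exists 0%N, 1.
have [m' [a' [a'0 h']]] := h i.
exists (m + m')%N, (Num.min (a / 2 ^+ m') (a' / 2 ^+ m)); split.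
  by rewrite lt_min !divr_gt0 ?exprn_gt0.
move=> j; rewrite inE => /orP[/eqP ->|js].
  by apply: reach_lb_le (reach_lb_add m h'); rewrite ge_min lexx orbT.
rewrite addnC; apply: reach_lb_le (reach_lb_add m' (hs j js)).
by rewrite ge_min lexx.
Qed.

Lemma reaches_connect q q' : connect (fun a b => 0 < w a b) q q' ->
  exists v, reaches q q' v.
Proof.
move=> /connectP[s]; elim: s q => [|q1 s IH] q /=.
  by move=> _ ->; exists 0; exact: reaches_refl.
move=> /andP[/reaches_step h1 hs] e; have [v h2] := IH _ hs e.
by exists (disp q + v); exact: reaches_trans h1 h2.
Qed.

Definition dirac (z : V) (q : K) (x : V) : R := (x == z)%:R.

Section Transience.
Variables (c : K) (kap : K -> V) (l1 l2 l3 : V).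
Hypothesis reach_c : forall q, reaches q c (kap q).
Hypothesis loop1 : reaches c c l1.
Hypothesis loop2 : reaches c c l2.
Hypothesis loop3 : reaches c c l3.
Hypothesis indep : forall a1 a2 a3 b1 b2 b3 : nat,
  l1 *+ a1 + l2 *+ a2 + l3 *+ a3 = l1 *+ b1 + l2 *+ b2 + l3 *+ b3 ->
  [/\ a1 = b1, a2 = b2 & a3 = b3].

(** A Doeblin condition: from any state the walk can go to [c] and run through any subset of the
    three loops, all eight possibilities in the same time and with probability at least [p] each. *)
Lemma cube_minorization : exists m p, [/\ (0 < m)%N, 0 < p <= 1 &
  forall F, (forall q x, 0 <= F q x) -> forall q x,
  p * cube l1 l2 l3 (F c) (x + kap q) <= iter m lazy_op F q x].
Proof.
pose v (i : K * (bool * bool * bool)) :=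
  kap i.1 + (l3 *+ i.2.2 + (l2 *+ i.2.1.2 + l1 *+ i.2.1.1)).
have rmul l (b : bool) : reaches c c l -> reaches c c (l *+ b).
  by case: b; rewrite ?mulr1n ?mulr0n// => _; exact: reaches_refl.
have [m [a [a0 h]]] := @reaches_uniform _ (fun i => i.1) (fun=> c) v (fun i =>
  reaches_trans (reach_c i.1) (reaches_trans (rmul _ _ loop3)
    (reaches_trans (rmul _ _ loop2) (rmul _ _ loop1)))).
(* One more waiting step makes the block length positive, so that time can be divided into
   blocks. *)
have {}h i : reach_lb i.1 c (v i) m.+1 (a / 2).
  by have := reach_lb_add 1 (h i); rewrite expr1.
have a1 : a / 2 <= 1.
  have := h (c, (true, true, true)) (fun _ _ => 1) (fun _ _ => ler01) 0.
  by rewrite mulr1 => /le_trans -> //; apply: iter_lazy_ub.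
exists m.+1, (a / 2); split=> [//||F F0 q x]; first by rewrite a1 divr_gt0.
have hb b1 b2 b3 := h (q, (b1, b2, b3)) F F0 x.
rewrite /cube /half_shift.
have := (hb true true true, hb true true false, hb true false true,
  hb true false false, hb false true true, hb false true false,
  hb false false true, hb false false false).
rewrite /v /= !mulr1n !mulr0n !add0r !addr0 !addrA.
case=> [[[[[[[H1 H2] H3] H4] H5] H6] H7] H8]; move: H1 H2 H3 H4 H5 H6 H7 H8.
have -> : x + kap q + l3 + l2 + l1 = x + kap q + l1 + l2 + l3.
  by rewrite (addrAC _ l2 l1) (addrAC _ l3 l1) (addrAC _ l3 l2).
rewrite (addrAC _ l2 l1) (addrAC _ l3 l1) (addrAC _ l3 l2).
lra.
Qed.

Section Estimate.
Variables (m : nat) (p : R).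
Hypothesis m_gt0 : (0 < m)%N.
Hypothesis p01 : 0 < p <= 1.
Hypothesis minor : forall F, (forall q x, 0 <= F q x) -> forall q x,
  p * cube l1 l2 l3 (F c) (x + kap q) <= iter m lazy_op F q x.

(** This is the minorization applied to the nonnegative function [M - F]. *)
Lemma minorized_contraction F M : 0 <= M -> (forall q x, F q x <= M) ->
  forall q x, iter m lazy_op F q x <=
    (1 - p) * M + p * cube l1 l2 l3 (F c) (x + kap q).
Proof.
move=> M0 FM q x.
have FM0 q' x' : 0 <= M - F q' x' by rewrite subr_ge0.
have := minor FM0 q x.
have -> : cube l1 l2 l3 (fun x => M - F c x) (x + kap q) =
    M - cube l1 l2 l3 (F c) (x + kap q).
  by rewrite /cube /half_shift; field.
rewrite (@iter_lazyB _ (fun _ _ => M)).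
have : iter m lazy_op (fun _ _ => M) q x <= M by apply: iter_lazy_ub.
lra.
Qed.

(** Each block adds, with weight [p], one more cube average. By translation invariance this average
    commutes with the lazy walk and can be moved onto the indicator of [z]. *)
Lemma iter_minorized_bound z n N q x :
  iter n (iter m lazy_op) (fun _ => iter N (cube l1 l2 l3) (fun y => (y == z)%:R)) q x
    <= green_bd p n N.
Proof.
elim: n N q x => [|n IH] N q x.
  by apply: le_trans (cube_tail_diff N); exact: iter_cube_dirac_bound.
rewrite iterS.
have /andP[p0 p1] := p01.
apply: le_trans (minorized_contraction _ (IH N) q x) _.
  by apply: green_bd_ge0; rewrite p1 ltW.
rewrite /= lerD2l ler_pM2l//.
have comm F : cube l1 l2 l3 (iter n (iter m lazy_op) F c) =
    iter n (iter m lazy_op) (fun q => cube l1 l2 l3 (F q)) c.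
  suff -> : iter n (iter m lazy_op) (fun q => cube l1 l2 l3 (F q)) =
    fun q => cube l1 l2 l3 (iter n (iter m lazy_op) F q) by [].
  by elim: (n) => [//|k IHk]; rewrite !iterS IHk iter_lazy_cube.
by rewrite comm; exact: (IH N.+1 c (x + kap q)).
Qed.

Lemma iter_lazy_dirac_bound z l q x :
  iter l lazy_op (dirac z) q x <= green_bd p (l %/ m) 0.
Proof.
have /andP[p0 p1] := p01.
have iterM F j : iter j (iter m lazy_op) F = iter (j * m) lazy_op F.
  by elim: j => [//|j IH]; rewrite iterS IH -iterD mulSn.
rewrite {1}(divn_eq l m) addnC iterD; apply: iter_lazy_ub.
  by apply: green_bd_ge0; rewrite p1 ltW.
by move=> q' x'; rewrite -iterM; exact: (iter_minorized_bound z _ 0).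
Qed.

End Estimate.
End Transience.
End WeightedChain.

(** * The Green function of a transient lazy walk *)

Section TransientPotential.
Context {R : realType} {K : finType} {V : zmodType}.
Variables (w : K -> K -> R) (disp : K -> V).
Hypothesis w_ge0 : forall q q', 0 <= w q q'.
Hypothesis w_le1 : forall q, \sum_q' w q q' <= 1.
Variables (c : K) (kap : K -> V) (l1 l2 l3 : V).
Hypothesis reach_c : forall q, reaches w disp q c (kap q).
Hypothesis loop1 : reaches w disp c c l1.
Hypothesis loop2 : reaches w disp c c l2.
Hypothesis loop3 : reaches w disp c c l3.
Hypothesis indep : forall a1 a2 a3 b1 b2 b3 : nat,
  l1 *+ a1 + l2 *+ a2 + l3 *+ a3 = l1 *+ b1 + l2 *+ b2 + l3 *+ b3 ->
  [/\ a1 = b1, a2 = b2 & a3 = b3].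

(** The bounds on the terms do not involve [z], [q], [x] and have bounded partial sums, so one
    truncation serves all targets and starting points. *)
Lemma uniform_tail (eps : R) : 0 < eps -> exists L, forall L' z q x,
  \sum_(l < L') iter l (lazy_op w disp) (dirac z) q x <=
  \sum_(l < L) iter l (lazy_op w disp) (dirac z) q x + eps.
Proof.
move=> eps0.
have [m [p [m0 p01 minor]]] := cube_minorization w_ge0 w_le1 reach_c loop1 loop2 loop3.
have p01' : 0 <= p <= 1 by case/andP: p01 => /ltW -> ->.
pose b l := green_bd p (l %/ m) 0.
have b0 l : 0 <= b l by exact: green_bd_ge0.
have sumb n : \sum_(l < n * m) b l = (\sum_(i < n) green_bd p i 0) *+ m.
  elim: n => [|n IH]; first by rewrite mul0n !big_ord0 mul0rn.
  rewrite mulSn addnC big_split_ord /= IH big_ord_recr mulrnDl; congr (_ + _).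
  rewrite (eq_bigr (fun=> green_bd p n 0)) ?sumr_const ?card_ord// => i _.
  by rewrite /b divnMDl// divn_small ?addn0.
pose s n := \sum_(l < n) b l.
have s_nd : {homo s : n k / (n <= k)%N >-> n <= k}.
  apply: homo_leq => [//|? ? ?|n]; first exact: le_trans.
  by rewrite /s big_ord_recr lerDl.
have s_ub n : s n <= (cube_tail 0 / p) *+ m.
  apply: (@le_trans _ _ (s (n * m)%N)); first by apply: s_nd; rewrite leq_pmulr.
  by rewrite /s sumb lerMn2r green_bd_sum ?orbT.
have s_sup : has_sup (range s).
  split; first by exists (s 0%N), 0%N.
  by exists ((cube_tail 0 / p) *+ m) => _ [n _ <-].
have [_ [L _ <-] hL] := sup_adherent eps0 s_sup.
exists L => L' z q x.
have [h|h] := leqP L' L.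
  rewrite -(subnKC h) big_split_ord /= -addrA lerDl addr_ge0 ?(ltW eps0)//.
  by apply: sumr_ge0 => i _; apply: iter_lazy_ge0 => // *; rewrite ler0n.
rewrite -(subnKC (ltnW h)) big_split_ord /= lerD2l; move: (L' - L)%N => k.
apply: (@le_trans _ _ (\sum_(i < k) b (L + i)%N)).
  by apply: ler_sum => i _; apply: iter_lazy_dirac_bound minor _ _ _ _.
have : s (L + k)%N <= sup (range s) by apply: ub_le_sup; [case: s_sup|exists (L + k)%N].
rewrite {1}/s big_split_ord /= -/(s L).
by move: hL; lra.
Qed.

(** [g] is the Green function of the lazy walk with target [z]. A function is superharmonic for the
    lazy walk exactly when it is so for the original one, so laziness disappears from the second
    property. *)
Lemma transient_potential (eps : R) : 0 < eps -> exists L, forall z,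
  exists g : K -> V -> R, [/\ forall q x, 0 <= g q x,
    forall q x, walk_op w disp g q x <= g q x, forall q, 1 <= g q z &
    forall q x, g q x <= \sum_(l < L) iter l (lazy_op w disp) (dirac z) q x + eps].
Proof.
move=> /uniform_tail[L hL]; exists L => z.
pose G n q x := \sum_(l < n) iter l (lazy_op w disp) (dirac z) q x : R.
have it0 l q x : 0 <= iter l (lazy_op w disp) (dirac z) q x :> R.
  by apply: iter_lazy_ge0 => // *; rewrite ler0n.
have G_nd q x : {homo (fun n => G n q x) : n k / (n <= k)%N >-> n <= k}.
  apply: homo_leq => [//|? ? ?|n]; first exact: le_trans.
  by rewrite /G big_ord_recr lerDl.
have G_ub q x : has_ubound (range (fun n => G n q x)).
  by exists (G L q x + eps) => _ [n _ <-]; exact: hL.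
have GS n q x : G n.+1 q x = G n q x + iter n (lazy_op w disp) (dirac z) q x.
  by rewrite /G big_ord_recr.
have G_cvg q x := nondecreasing_cvgn (@G_nd q x) (G_ub q x).
pose g q x := sup (range (fun n => G n q x)).
have Gg n q x : G n q x <= g q x by apply: ub_le_sup => //; exists n.
have lazyG n q x : lazy_op w disp (G n) q x <= g q x.
  apply: le_trans (Gg n.+1 q x); rewrite [leRHS]/G big_ord_recl /=.
  have -> : lazy_op w disp (G n) q x = \sum_(i < n) iter (bump 0 i) (lazy_op w disp) (dirac z) q x.
    elim: n => [|n IH].
      rewrite big_ord0 /lazy_op /walk_op /G big_ord0 big1 ?addr0 ?mul0r// => i _.
      by rewrite big_ord0 mulr0.
    rewrite big_ord_recr -IH -[bump 0 _]/(n.+1) iterS /lazy_op /walk_op GS.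
    under eq_bigr do rewrite GS mulrDr.
    by rewrite big_split /=; field.
  by rewrite lerDr /dirac ler0n.
exists g; split=> [q x|q x|q|q x].
- by apply: le_trans (Gg 0%N q x); rewrite /G big_ord0.
- have : lazy_op w disp g q x <= g q x.
    have cvg_lazy : (fun n => lazy_op w disp (G n) q x) @ \oo --> lazy_op w disp g q x.
      apply: cvgMl; apply: cvgD; first exact: G_cvg.
      apply: cvg_big => [|i _]; first exact: add_continuous.
      by apply: cvgMr; exact: G_cvg.
    rewrite -(cvg_lim _ cvg_lazy)//; apply: limr_le; last by near=> n; exact: lazyG.
    by apply/cvg_ex; eexists; exact: cvg_lazy.
  by rewrite /lazy_op; lra.
- by apply: le_trans (Gg 1%N q z); rewrite /G big_ord1 /= /dirac eqxx.
- apply: ge_sup; first by exists (G 0%N q x), 0%N.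
  by move=> _ [n _ <-]; exact: hL.
Unshelve. all: end_near. Qed.

End TransientPotential.

Definition norm1 (d : nat) (x : 'rV[int]_d) : nat := (\sum_i `|x 0%R i|)%N.

Section Norm1.
Variable d : nat.
Implicit Types x y : 'rV[int]_d.

Lemma norm1_entry x i : (`|x 0%R i| <= norm1 x)%N.
Proof. by rewrite /norm1 (bigD1 i)//= leq_addr. Qed.

Lemma norm1D x y : (norm1 (x + y) <= norm1 x + norm1 y)%N.
Proof.
rewrite /norm1 -big_split /=; apply: leq_sum => i _; rewrite mxE.
by move: (x _ _) (y _ _) => a b; lia.
Qed.

Lemma norm1N x : norm1 (- x) = norm1 x.
Proof. by apply: eq_bigr => i _; rewrite mxE abszN. Qed.

End Norm1.

Lemma iter_lazy_far (R : realType) (K : finType) (d : nat) (w : K -> K -> R)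
    (disp : K -> 'rV[int]_d) (D l : nat) (z x : 'rV[int]_d) (q : K) :
  (forall q, norm1 (disp q) <= D)%N -> (l * D < norm1 (z - x))%N ->
  iter l (lazy_op w disp) (dirac z) q x = 0.
Proof.
move=> hD; elim: l q x => [|l IH] q x h.
  by rewrite /= /dirac; case: eqP h => // ->; rewrite subrr /norm1 big1// => i _; rewrite mxE.
rewrite iterS /lazy_op /walk_op IH ?big1 ?addr0 ?mul0r//.
  move=> q' _; rewrite IH ?mulr0//.
  have := norm1D (z - (x + disp q)) (disp q).
  rewrite opprD addrA addrNK; have := hD q; move: h; rewrite mulSn.
  by move: (norm1 _) (norm1 _) (norm1 _) (l * D)%N => a b n k; lia.
by move: h; rewrite mulSn; move: (norm1 _) (l * D)%N => a k; lia.
Qed.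

(** * Integral planes *)

Section IntegerKernel.
Variable d : nat.
Implicit Types (P : 'rV[int]_d -> Prop).

Definition Zindep (u v t : 'rV[int]_d) := forall a b c : int,
  a *: u + b *: v + c *: t = 0 -> [/\ a = 0, b = 0 & c = 0].

Lemma Zindep_nat u v t : Zindep u v t -> forall a1 a2 a3 b1 b2 b3 : nat,
  u *+ a1 + v *+ a2 + t *+ a3 = u *+ b1 + v *+ b2 + t *+ b3 ->
  [/\ a1 = b1, a2 = b2 & a3 = b3].
Proof.
move=> h a1 a2 a3 b1 b2 b3 e.
have [] := h (a1%:R - b1%:R) (a2%:R - b2%:R) (a3%:R - b3%:R).
  rewrite !scalerBl !scaler_nat; move/eqP: e; rewrite -subr_eq0 => /eqP <-.
  by rewrite !opprD [RHS]addrACA; congr (_ + _); rewrite addrACA.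
by move=> /subr0_eq/eqP h1 /subr0_eq/eqP h2 /subr0_eq/eqP h3; split; apply/eqP;
  move: h1 h2 h3; rewrite !eqr_nat.
Qed.

(** Vectors of [P] are picked greedily; if independence stops at two or fewer, every element of [P]
    has a nonzero multiple in their integral span. *)
Lemma Zindep_or_plane P :
  (exists u v t, [/\ P u, P v, P t & Zindep u v t]) \/
  (exists u v : 'rV[int]_d, forall x, P x ->
     exists D a b : int, D != 0 /\ D *: x = a *: u + b *: v).
Proof.
have [hx|hn] := pselect (exists u v t, [/\ P u, P v, P t & Zindep u v t]); first by left.
right.
have [[u [Pu u0]]|none] := pselect (exists u, P u /\ u != 0); last first.
  exists 0, 0 => x Px; exists 1, 0, 0; split=> //.
  rewrite !scale0r addr0 scale1r; apply/eqP; apply/negPn/negP => x0.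
  by apply: none; exists x.
have scal0 (a : int) : a *: u = 0 -> a = 0.
  move=> /rowP au; have /rV0Pn[i ui] := u0.
  have := au i; rewrite !mxE => /eqP; rewrite mulf_eq0 (negbTE ui) orbF.
  by move/eqP.
have [[v [Pv hv]]|none] := pselect (exists v, P v /\
    forall a b : int, a *: u + b *: v = 0 -> a = 0 /\ b = 0); last first.
  exists u, 0 => x Px.
  have [[b [a [D0 e]]]|h] := pselect (exists D a : int, D != 0 /\ D *: x = a *: u).
    by exists b, a, 0; rewrite scaler0 addr0.
  case: none; exists x; split=> // a b e; have [b0|b0] := eqVneq b 0.
    by split=> //; apply: scal0; move: e; rewrite b0 scale0r addr0.
  case: h; exists b, (- a); split=> //; rewrite scaleNr.
  by apply/eqP; rewrite -addr_eq0 addrC e.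
exists u, v => x Px.
have [h|h] := pselect (exists D a b : int, D != 0 /\ D *: x = a *: u + b *: v); first by [].
case: hn; exists u, v, x; split=> // a b c e; have [c0|c0] := eqVneq c 0.
  by move: e; rewrite c0 scale0r addr0 => /hv[-> ->].
case: h; exists c, (- a), (- b); split=> //; rewrite !scaleNr -opprD.
by apply/eqP; rewrite -addr_eq0 addrC e.
Qed.

End IntegerKernel.

(** In the Smith normal form of the two rows only the first two columns of the diagonal factor can
    be nonzero, so the last [e] columns of the inverse right factor kill [u] and [v]. Multiplication
    by [N] serves as the projection modulo a plane containing both. *)
Lemma plane_annihilator (e : nat) (u v : 'rV[int]_(2 + e)) :
  exists N : 'M[int]_(2 + e, e),
    [/\ forall t : 'cV_e, N *m t = 0 -> t = 0, u *m N = 0 & v *m N = 0].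
Proof.
have [L _ [Rm Ru [s _ eW]]] := int_Smith_normal_form (col_mx u v).
exists (rsubmx (invmx Rm)).
have inj t : rsubmx (invmx Rm) *m t = 0 -> t = 0.
  move=> h; have : invmx Rm *m col_mx 0 t = 0.
    by rewrite -[invmx Rm]hsubmxK mul_row_col mulmx0 add0r.
  move/(congr1 (mulmx Rm)); rewrite mulmxA mulmxV// mul1mx mulmx0.
  by move/(congr1 dsubmx); rewrite col_mxKd => ->; apply/matrixP => i j; rewrite !mxE.
suff : col_mx u v *m rsubmx (invmx Rm) = 0.
  rewrite mul_col_mx => h; split; [exact: inj| |].
    by move/(congr1 usubmx): h; rewrite col_mxKu => ->; rewrite raddf0.
  by move/(congr1 dsubmx): h; rewrite col_mxKd => ->; rewrite raddf0.
rewrite eW -!mulmxA mulmx_rsub mulmxV//.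
have -> : (\matrix_(i < 1 + 1, j < 2 + e) (s`_i *+ ((i : nat) == j))) *m rsubmx 1%:M =
   0 :> 'M[int]_(1 + 1, e).
  rewrite mulmx_rsub mulmx1; apply/matrixP => i j; rewrite !mxE /=.
  by have -> : (i == 2 + j :> nat)%N = false by have := ltn_ord i; lia.
by rewrite mulmx0.
Qed.

Lemma mulmx_norm1_bound (d e : nat) (N : 'M[int]_(d, e)) :
  exists C, forall z j, (`|(z *m N) 0%R j| <= norm1 z * C)%N.
Proof.
exists (\sum_i \sum_j `|N i j|)%N => z j.
apply: (@leq_trans (\sum_i `|z 0%R i| * `|N i j|)%N).
  rewrite mxE; elim/big_rec2: _ => // i a b _ h.
  apply: (@leq_trans (`|(z 0 i * N i j)%R| + `|b|)%N); last by rewrite abszM leq_add2l.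
  by move: (z 0 i * N i j) => y; lia.
rewrite /norm1 big_distrl /=; apply: leq_sum => i _; rewrite leq_mul2l; apply/orP; right.
by rewrite (bigD1 i)//= (bigD1 j)//= -addnA leq_addr.
Qed.

(** * Targets far from a suitable plane are missed with probability close to 1 *)

Section WalkEscape.
Context {R : realType} {K : finType} {e : nat}.
Variables (w : K -> K -> R) (disp : K -> 'rV[int]_(2 + e)).
Hypothesis w_ge0 : forall q q', 0 <= w q q'.
Hypothesis w_le1 : forall q, \sum_q' w q q' <= 1.

(** Three independent loops at [c] make the walk transient, and the Green function is small at far
    targets. Otherwise all loops lie in a plane, which [N] annihilates, and the indicator that [z]
    is still accessible is a superharmonic function vanishing at the start. *)
Lemma walk_escape (c : K) (eps : R) : 0 < eps ->
  (forall q, exists v, reaches w disp q c v) ->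
  exists (N : 'M[int]_(2 + e, e)) (B : nat),
  (forall t : 'cV_e, N *m t = 0 -> t = 0) /\
  forall z, (exists j, (B < `|(z *m N) 0%R j|)%N) ->
  exists g : K -> 'rV[int]_(2 + e) -> R,
   [/\ forall q x, 0 <= g q x, forall q x, walk_op w disp g q x <= g q x,
       forall q, 1 <= g q z & g c 0 <= eps].
Proof.
move=> eps0 /choice[kap hkap].
have [[l1 [l2 [l3 [h1 h2 h3 /Zindep_nat ind]]]]|[u [v plane]]] :=
  Zindep_or_plane (fun v => reaches w disp c c v).
  have [L hL] := transient_potential w_ge0 w_le1 hkap h1 h2 h3 ind eps0.
  (* Here [z] only has to be far away, and a large entry of [z *m N] ensures this for whatever
     [N]. *)
  have [N [injN _ _]] := @plane_annihilator e 0 0.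
  have [C hC] := mulmx_norm1_bound N.
  pose D := (\sum_q norm1 (disp q))%N.
  have hD q : (norm1 (disp q) <= D)%N by rewrite /D (bigD1 q)//= leq_addr.
  exists N, (L * D * C)%N; split=> // z [j hj].
  have [g [g0 gw gz gL]] := hL z; exists g; split=> //.
  have far : (L * D < norm1 z)%N.
    by rewrite ltnNge; apply/negP => le; have := leq_trans hj (hC z j); rewrite ltnNge leq_mul2r le orbT.
  apply: le_trans (gL c 0) _; rewrite big1 ?add0r// => l _.
  apply: (@iter_lazy_far _ _ _ w _ _ l z 0 c hD); rewrite subr0; apply: leq_ltn_trans far.
  by rewrite leq_mul2r ltnW ?orbT.
have [N [injN uN vN]] := plane_annihilator u v.
have loop0 x : reaches w disp c c x -> x *m N = 0.
  move=> /plane[D [a [b [D0 eD]]]].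
  have : D *: (x *m N) = 0.
    by rewrite scalemxAl eD mulmxDl -!scalemxAl uN vN !scaler0 addr0.
  move=> /matrixP h; apply/matrixP => i j; have := h i j; rewrite !mxE => /eqP.
  by rewrite mulf_eq0 (negbTE D0) => /eqP.
(* A path from [c] to displacement [z], closed up by [kap q'], is a loop; hence [z *m N] is the
   opposite of [kap q' *m N], which [B] bounds. *)
pose B := (\sum_q \sum_j `|(kap q *m N) 0%R j|)%N.
exists N, B; split=> // z [j hj].
pose reach q x := `[< exists q', reaches w disp q q' (z - x) >].
exists (fun q x => (reach q x)%:R); split=> [q x|q x|q|]; first exact: ler0n.
- have [hr|hr] := boolP (reach q x); last first.
    rewrite /walk_op big1// => q' _.
    have [->|w0] := eqVneq (w q q') 0; first by rewrite mul0r.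
    have wpos : 0 < w q q' by rewrite lt_neqAle eq_sym w0 w_ge0.
    have -> : reach q' (x + disp q) = false; last by rewrite mulr0.
    apply/negP => /asboolP[q'' r]; move/asboolP: hr; apply; exists q''.
    have := reaches_trans w_ge0 (reaches_step disp w_ge0 wpos) r.
    by have <- : disp q + (z - (x + disp q)) = z - x by rewrite [LHS]addrC opprD addrA subrK.
  rewrite [leRHS](_ : _ = 1)//; apply: (walk_op_ub disp w_ge0 w_le1 ler01).
  by move=> q' x'; case: (reach _ _); rewrite ?lexx ?ler01.
- have -> : reach q z; last exact: lexx.
  by apply/asboolP; exists q; rewrite subrr; exact: reaches_refl.
- have -> : reach c 0 = false; last by rewrite ltW.
  apply/negP => /asboolP[q']; rewrite subr0 => r.
  have := loop0 _ (reaches_trans w_ge0 r (hkap q')); rewrite mulmxDl => /eqP.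
  rewrite addr_eq0 => /eqP zN; move: hj; rewrite zN mxE abszN ltnNge.
  by rewrite /B (bigD1 q')//= (bigD1 j)//= -addnA leq_addr.
Qed.

End WalkEscape.

(** * Restriction to a strongly connected component of the states *)

Section StrongComponent.
Context {R : realType} {K : finType}.
Variable (w : K -> K -> R).

Definition edge : rel K := fun a b => 0 < w a b.

Definition scc (q0 q : K) : bool := connect edge q0 q && connect edge q q0.

Lemma scc_refl q0 : scc q0 q0. Proof. by rewrite /scc connect0. Qed.

(* Outside the component of [q0] the walk jumps to [q0], so that every state
   leads to [q0]; no edge leaves the component. *)
Definition scc_weight (q0 q q' : K) : R :=
  if scc q0 q then (if scc q0 q' then w q q' else 0) else (q' == q0)%:R.

Hypothesis w_ge0 : forall q q', 0 <= w q q'.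
Hypothesis w_le1 : forall q, \sum_q' w q q' <= 1.

Lemma scc_weight_ge0 q0 q q' : 0 <= scc_weight q0 q q'.
Proof. by rewrite /scc_weight; case: ifP => _; [case: ifP|rewrite ler0n]. Qed.

Lemma scc_weight_le1 q0 q : \sum_q' scc_weight q0 q q' <= 1.
Proof.
rewrite /scc_weight; have [_|_] := boolP (scc q0 q).
  by apply: le_trans (w_le1 q); apply: ler_sum => q' _; case: ifP.
by rewrite (bigD1 q0)//= eqxx big1 ?addr0// => q' /negbTE ->.
Qed.

Lemma scc_weight_connect q0 q : connect (fun a b => 0 < scc_weight q0 a b) q q0.
Proof.
have [cq|/negbTE nq] := boolP (scc q0 q); last first.
  by apply: connect1; rewrite /scc_weight nq eqxx ltr01.
have /andP[c1 /connectP[s sp sl]] := cq.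
elim: s q cq c1 sp sl => [|q1 s IH] q cq c1 /=; first by move=> _ <-.
move=> /andP[e1 sp] sl.
have c2 : connect edge q0 q1 by apply: connect_trans c1 (connect1 e1).
have cq1 : scc q0 q1 by rewrite /scc c2; apply/connectP; exists s.
apply: connect_trans (connect1 _) (IH q1 cq1 c2 sp sl).
by rewrite /scc_weight cq cq1.
Qed.

Lemma scc_escape (e : nat) (disp : K -> 'rV[int]_(2 + e)) (q0 : K) (eps : R) :
  0 < eps ->
  exists (N : 'M[int]_(2 + e, e)) (B : nat),
  (forall t : 'cV_e, N *m t = 0 -> t = 0) /\
  forall z, (exists j, (B < `|(z *m N) 0%R j|)%N) ->
  exists g : K -> 'rV[int]_(2 + e) -> R,
   [/\ forall q x, 0 <= g q x,
       forall q x, scc q0 q ->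
         \sum_(q' | scc q0 q') w q q' * g q' (x + disp q) <= g q x,
       forall q, 1 <= g q z & g q0 0 <= eps].
Proof.
move=> eps0.
have [|N [B [injN h]]] := @walk_escape R K e (scc_weight q0) disp
    (scc_weight_ge0 q0) (scc_weight_le1 q0) q0 eps eps0.
  by move=> q; apply: reaches_connect (scc_weight_connect q0 q); exact: scc_weight_ge0.
exists N, B; split=> // z /h[g [g0 gw gz gc]]; exists g; split=> // q x cq.
apply: le_trans (gw q x); rewrite /walk_op big_mkcond /=; apply: ler_sum => q' _.
by rewrite /scc_weight cq; case: ifP => _; rewrite ?mul0r.
Qed.

(** Take a state accessible from [q] with the fewest accessible states: whatever it leads to has the
    same accessible set. *)
Lemma exists_terminal_state q : exists c, connect edge q c /\
  forall q', connect edge c q' -> connect edge q' c.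
Proof.
pose r c := #|[pred q' | connect edge c q']|.
have [c cq cmin] := arg_minnP r (connect0 edge q).
exists c; split=> // q' cq'.
have sub : [pred x | connect edge q' x] \subset [pred x | connect edge c x].
  by apply/fintype.subsetP => x; rewrite !inE; exact: connect_trans.
have := cmin q' (connect_trans cq cq'); rewrite (geq_leqif (subset_leqif_card sub)).
by move=> /fintype.subsetP/(_ c); rewrite !inE connect0; exact.
Qed.

End StrongComponent.

(** * Robots with one stone *)

Section GenericCell.
Variable d : nat.

(** When [y] vanishes on the new functional, a vector [y'] that does not is added to a multiple of
    [y] so large that the functionals already treated stay nonzero. *)
Lemma generic_direction (s : seq 'cV[int]_d) : (forall L, L \in s -> L != 0) ->
  exists y : 'rV[int]_d, forall L, L \in s -> (y *m L) 0 0 != 0.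
Proof.
elim: s => [_|L s IH hs]; first by exists 0.
have [|y hy] := IH; first by move=> L' L's; apply: hs; rewrite inE L's orbT.
have [y0|y0] := eqVneq ((y *m L) 0 0) 0; last first.
  by exists y => L'; rewrite inE => /orP[/eqP ->//|]; exact: hy.
have /matrix0Pn[i [j Lij]] : L != 0 by apply: hs; rewrite inE eqxx.
pose y' : 'rV[int]_d := delta_mx 0 i.
have y'L (L' : 'cV[int]_d) : (y' *m L') 0 0 = L' i 0 by rewrite -rowE mxE.
pose t := (1 + \sum_(L' <- s) `|(y' *m L') 0%R 0%R|)%N.
have E (L' : 'cV[int]_d) : ((t%:Z *: y + y') *m L') 0 0 =
    t%:Z * (y *m L') 0 0 + (y' *m L') 0 0.
  by rewrite mulmxDl -scalemxAl mxE; congr (_ + _); rewrite mxE.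
exists (t%:Z *: y + y') => L'; rewrite inE E.
move=> /orP[/eqP ->|L's].
  by rewrite y0 mulr0 add0r y'L; rewrite ord1 in Lij.
have := hy _ L's; have : (`|(y' *m L') 0%R 0%R| < t)%N.
  by rewrite /t (big_rem L')//= add1n ltnS leq_addr.
move: ((y *m L') 0 0) ((y' *m L') 0 0) (t) => a b u hb ha.
apply/eqP => e; have : (u <= `|(u%:Z * a)%R|)%N by rewrite abszM leq_pmulr// absz_gt0.
by move: e hb; move: (u%:Z * a) => ua; lia.
Qed.

Lemma generic_cell (s : seq 'cV[int]_d) (B : nat) : (forall L, L \in s -> L != 0) ->
  exists x : 'rV[int]_d, forall L, L \in s -> (B < `|(x *m L) 0%R 0%R|)%N.
Proof.
move=> /generic_direction[y hy]; exists (B.+1%:Z *: y) => L /hy h.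
by rewrite -scalemxAl mxE abszM leq_pmulr// absz_gt0.
Qed.

End GenericCell.

(** * The chain of the robot relative to its stone *)

Section RelativeChain.
Context {k : nat} (r : robot k 1).
Local Notation Q := (state r).

Definition see_trans (q : Q) (see b : bool) : Q :=
  trans q (cat_tuple [tuple see] [tuple false; b]).

Definition carries (q : Q) : bool := tnth (carry q) ord0.

(* A relative configuration: the stone, the robot relative to the stone, the state. *)
Definition rconf : Type := (cell k * cell k * Q)%type.

Definition carried (y : cell k) (q : Q) : cell k :=
  if (y == 0) && carries q then move q else 0.

Definition rel_step (c : rconf) (b : bool) : rconf :=
  let: (s, y, q) := c in
  (s + carried y q, y + (move q - carried y q), see_trans q (y == 0) b).

Definition hits (x : cell k) : pred rconf := fun c => c.1.1 + c.1.2 == x.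

(* The motion relative to the stone as long as the stone is not seen. *)
Definition off_step (c : cell k * Q) (b : bool) : cell k * Q :=
  (c.1 + move c.2, see_trans c.2 false b).

Definition met : pred (cell k * Q) := fun c => c.1 == 0.

Inductive reachable : rconf -> Prop :=
| reachable_init : reachable (0, 0, init_state r)
| reachable_step c b : reachable c -> reachable (rel_step c b).

Lemma norm1_move q : norm1 (@move _ _ r q) = 1%N.
Proof.
have n1 i : norm1 (unit_cell i : cell k) = 1%N.
  rewrite /norm1 (bigD1 i)//= big1 ?mxE ?eqxx// => j ji.
  by rewrite mxE (negbTE ji) andbF.
have /existsP[i /orP[/eqP ->|/eqP ->]] := move_direction q; first exact: n1.
by rewrite norm1N n1.
Qed.

Lemma off_reachable s y q b : y != 0 -> reachable (s, y, q) ->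
  reachable (s, y + move q, see_trans q false b).
Proof.
move=> y0 h; have := reachable_step b h.
by rewrite /= /carried (negbTE y0) /= subr0 addr0.
Qed.

Lemma met_reachable s q b : reachable (s, 0, q) ->
  reachable (s + carried 0 q, move q - carried 0 q, see_trans q true b).
Proof. by move=> /(reachable_step b); rewrite /= eqxx add0r. Qed.

Section Probabilities.
Context {R : realType}.

Definition cover_prob (x : cell k) : rconf -> R := vlim rel_step (hits x) (fun=> 1).

Definition return_prob : cell k * Q -> R := vlim off_step met (fun=> 1).

Definition return_law (q' : Q) : cell k * Q -> R :=
  vlim off_step met (fun c => (c.2 == q')%:R).

Definition away_weight (q q' : Q) : R :=
  ((see_trans q false false == q')%:R + (see_trans q false true == q')%:R) / 2.

Lemma one01 (X : Type) (c : X) : 0 <= (fun=> 1 : R) c <= 1.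
Proof. by rewrite ler01 lexx. Qed.

Lemma eq01 (X : Type) (q' : Q) (f : X -> Q) (c : X) : 0 <= ((f c == q')%:R : R) <= 1.
Proof. by rewrite ler0n; case: (_ == _); rewrite ?lexx ?ler01. Qed.

Lemma away_weight_ge0 q q' : 0 <= away_weight q q'.
Proof. by rewrite divr_ge0// addr_ge0// ler0n. Qed.

Lemma sum_away_weight q (P : pred Q) (f : Q -> R) :
  \sum_(q' | P q') away_weight q q' * f q' =
  ((if P (see_trans q false false) then f (see_trans q false false) else 0) +
   (if P (see_trans q false true) then f (see_trans q false true) else 0)) / 2.
Proof.
have one a : \sum_(q' | P q') (a == q')%:R * f q' = if P a then f a else 0.
  case: ifPn => Pa; last first.
    rewrite big1// => q' Pq'; case: eqP => [e|_]; last by rewrite mul0r.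
    by rewrite e Pq' in Pa.
  rewrite (bigD1 a)//= eqxx mul1r big1 ?addr0// => q' /andP[_ /negbTE].
  by rewrite eq_sym => ->; rewrite mul0r.
rewrite -!one -big_split mulr_suml; apply: eq_bigr => q' _ /=.
by rewrite /away_weight; field.
Qed.

Lemma away_weight_sum q : \sum_q' away_weight q q' <= 1.
Proof.
have := sum_away_weight q predT (fun=> 1); rewrite /=.
under eq_bigr do rewrite mulr1.
by move=> ->; lra.
Qed.

Lemma away_edge q b : edge away_weight q (see_trans q false b).
Proof.
rewrite /edge /away_weight divr_gt0//; case: b; rewrite eqxx.
  by rewrite ltr_wpDl// ler0n.
by rewrite ltr_pwDl// ler0n.
Qed.

Lemma away_edge_inv q q' : edge away_weight q q' -> exists b, q' = see_trans q false b.
Proof.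
rewrite /edge /away_weight; case: eqP => [<-|_]; first by exists false.
case: eqP => [<-|_]; first by exists true.
by rewrite addr0 mul0r ltxx.
Qed.

Lemma return_prob_step y q : y != 0 -> return_prob (y, q) =
  (return_prob (y + move q, see_trans q false false) +
   return_prob (y + move q, see_trans q false true)) / 2.
Proof. by move=> y0; rewrite /return_prob {1}vlim_step//; exact: one01. Qed.

Lemma return_law_step q' y q : y != 0 -> return_law q' (y, q) =
  (return_law q' (y + move q, see_trans q false false) +
   return_law q' (y + move q, see_trans q false true)) / 2.
Proof.
by move=> y0; rewrite /return_law {1}vlim_step// => c; exact: (@eq01 _ q' snd).
Qed.

Lemma return_law0 q' q : return_law q' (0, q) = (q == q')%:R.
Proof. by rewrite /return_law vlim_stop ?/met ?eqxx// => c; exact: (@eq01 _ q' snd). Qed.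

Lemma return_law_ge0 q' c : 0 <= return_law q' c.
Proof. by apply: vlim_ge0 => c'; exact: (@eq01 _ q' snd). Qed.

Lemma return_law_sum c : \sum_q' return_law q' c <= 1.
Proof.
have cvg : (fun n => \sum_q' val off_step met (fun c => (c.2 == q')%:R : R) n c) @ \oo
    --> \sum_q' return_law q' c.
  apply: cvg_big => [|q' _]; first exact: add_continuous.
  by apply: val_cvg => c'; exact: (@eq01 _ q' snd).
rewrite -(cvg_lim _ cvg)//; apply: limr_le; first by apply/cvg_ex; eexists; exact: cvg.
apply: nearW => n; elim: n c {cvg} => [|n IH] c /=.
  have [_|_] := boolP (met c); last by rewrite big1.
  by rewrite (bigD1 c.2)//= eqxx big1 ?addr0// => q' /negbTE; rewrite eq_sym => ->.
have [_|_] := boolP (met c).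
  by rewrite (bigD1 c.2)//= eqxx big1 ?addr0// => q' /negbTE; rewrite eq_sym => ->.
rewrite /avg -mulr_suml big_split /=.
by have := IH (off_step c false); have := IH (off_step c true); lra.
Qed.

(** If 1 is the mean of two numbers that are at most 1, both are 1; so certainty passes to the
    successors unless the cell has just been visited. [B] excludes the cells visited on the way to
    [c]. *)
Lemma cover_prob_reachable : (forall x, cover_prob x (0, 0, init_state r) = 1) ->
  forall c, reachable c -> exists B, forall x, (B < norm1 x)%N -> cover_prob x c = 1.
Proof.
move=> cov c; elim=> {c} [|c b _ [B hB]]; first by exists 0%N => x _; exact: cov.
exists (maxn B (norm1 (c.1.1 + c.1.2))) => x; rewrite gtn_max => /andP[xB xc].
have nh : ~~ hits x c by apply/negP => /eqP e; rewrite e ltnn in xc.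
have := hB x xB; rewrite /cover_prob vlim_step//; last exact: one01.
have le1 b' : vlim rel_step (hits x) (fun=> 1 : R) (rel_step c b') <= 1.
  by apply: vlim_le1; exact: one01.
by rewrite /avg; have := le1 false; have := le1 true; case: b; lra.
Qed.

End Probabilities.
End RelativeChain.

Lemma injective_col_neq0 (d e : nat) (N : 'M[int]_(d.+1, e.+1)) :
  (forall t : 'cV_e.+1, N *m t = 0 -> t = 0) ->
  forall L, L \in [:: N *m delta_mx 0 0; delta_mx 0 0 : 'cV_d.+1] -> L != 0.
Proof.
move=> injN L; rewrite !inE => /orP[] /eqP ->.
  apply/negP => /eqP/injN/matrixP/(_ 0 0); by rewrite !mxE.
by apply/negP => /eqP/matrixP/(_ 0 0); rewrite !mxE.
Qed.

(** * No robot with one stone covers Z^5 *)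

Section NoCover.
Context {R : realType} (r : robot 5 1).
Local Notation Q := (state r).
Local Notation ret := (@return_prob 5 r R).
Local Notation wf := (@away_weight 5 r R).
Local Notation reachable := (@reachable 5 r).

Hypothesis cover1 : forall x, @cover_prob 5 r R x (0, 0, init_state r) = 1.

Lemma ret01 c : 0 <= ret c <= 1.
Proof. by rewrite vlim_ge0 ?vlim_le1// => c'; exact: one01. Qed.

Lemma ret_met c : met c -> ret c = 1.
Proof. by move=> h; rewrite /return_prob vlim_stop// => c'; exact: one01. Qed.

(** A zero-one argument: a uniform positive lower bound on the return probability would make the
    return certain. The value 1/4 leaves room for an escape potential of another 1/4. *)
Lemma escape_amplification (q0 : Q) s0 y0 : reachable (s0, y0, q0) ->
  ret (y0, q0) < 1 ->
  exists s y q, [/\ reachable (s, y, q), connect (edge wf) q0 q & ret (y, q) < 4^-1].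
Proof.
move=> re0 ret1; have [//|none] := pselect (exists s y q,
  [/\ reachable (s, y, q), connect (edge wf) q0 q & ret (y, q) < 4^-1]).
have lb s y q : reachable (s, y, q) -> connect (edge wf) q0 q -> 4^-1 <= ret (y, q).
  by move=> h1 h2; rewrite leNgt; apply/negP => h; apply: none; exists s, y, q.
pose Inv (c : cell 5 * Q) := c.1 = 0 \/
  (exists s, reachable (s, c.1, c.2)) /\ connect (edge wf) q0 c.2.
(* If [1 - ret <= 3 / 4] everywhere, then even [1 - ret <= 3 / 4 * (1 - ret)] by comparison. *)
pose H (c : cell 5 * Q) := 1 - 4 / 3 * (1 - ret c) : R.
have : ret (y0, q0) <= H (y0, q0).
  apply: (@vlim_comparison _ _ _ _ _ Inv) => [[y q]|[y q]|[y q] b|[y q]|].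
  - case=> /= [y00|[[s h1] h2]]; rewrite /H.
      by rewrite ret_met ?/met ?y00//; lra.
    by have := lb _ _ _ h1 h2; lra.
  - by move=> _ /ret_met; rewrite /H => ->; lra.
  - move=> [/= ->|/= [[s h1] h2]]; rewrite /met ?eqxx//= => yn0; right; split.
      by exists s; exact: off_reachable.
    by apply: connect_trans h2 (connect1 _); exact: away_edge.
  - move=> _ yn0; rewrite /H (return_prob_step q yn0) /avg /=; lra.
  - by right; split; [exists s0|exact: connect0].
by rewrite /H; have /andP[_ _] := ret01 (y0, q0); move: ret1; lra.
Qed.

(** A robot likely to lose its stone follows an automaton-driven walk of its own and misses a
    generic cell. Among the states in which the stone may be lost, one with the fewest accessible
    states is taken: those accessible from it lie in its component, the only place where a potential
    is available. *)
Lemma return_prob1 s y q : reachable (s, y, q) -> ret (y, q) = 1.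
Proof.
move=> hre; apply/eqP; rewrite eq_le; have /andP[_ ->] /= := ret01 (y, q).
rewrite leNgt; apply/negP => hlt.
pose bad := [pred q | `[< exists s y, reachable (s, y, q) /\ ret (y, q) < 1 >]].
have badq : bad q by apply/asboolP; exists s, y.
pose rk c := #|[pred q' | connect (edge wf) c q']|.
have [q0 /asboolP[s0 [y0 [re0 lt0]]] qmin] := arg_minnP rk badq.
have comp s' y' q' : reachable (s', y', q') -> connect (edge wf) q0 q' ->
    ret (y', q') < 1 -> scc wf q0 q'.
  move=> h1 h2 h3; rewrite /scc h2 /=.
  have sub : [pred x | connect (edge wf) q' x] \subset [pred x | connect (edge wf) q0 x].
    by apply/fintype.subsetP => x; rewrite !inE; exact: connect_trans.
  have bq' : bad q' by apply/asboolP; exists s', y'.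
  have := qmin q' bq'; rewrite (geq_leqif (subset_leqif_card sub)).
  by move=> /fintype.subsetP/(_ q0); rewrite !inE connect0; exact.
have [s1 [y1 [q1 [re1 c1 lt1]]]] := escape_amplification re0 lt0.
have scc1 : scc wf q0 q1 by apply: comp re1 c1 _; lra.
have e0 : 0 < 4^-1 :> R by lra.
have [N [B [injN esc]]] := @scc_escape R Q wf (@away_weight_ge0 _ r R)
  (@away_weight_sum _ r R) 3 (@move _ _ r) q1 _ e0.
have [B1 cov1] := cover_prob_reachable cover1 re1.
pose a1 := s1 + y1.
have [x hx] := @generic_cell 5 [:: N *m delta_mx 0 0; delta_mx 0 0]
    (B1 + B + norm1 (a1 *m N))%N (@injective_col_neq0 4 2 N injN).
have hx1 : (B1 < norm1 x)%N.
  have := hx (delta_mx 0 0); rewrite !inE eqxx orbT => /(_ isT).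
  rewrite -colE mxE => h; apply: leq_trans (norm1_entry x 0).
  by apply: leq_ltn_trans h; rewrite -addnA leq_addr.
have hx2 : exists j, (B < `|((x - a1) *m N) 0%R j|)%N.
  exists 0; have := hx (N *m delta_mx 0 0); rewrite !inE eqxx => /(_ isT).
  rewrite mulmxA -colE mxE => h.
  have -> : ((x - a1) *m N) 0 0 = (x *m N) 0 0 - (a1 *m N) 0 0.
    by rewrite mulmxBl mxE; congr (_ + _); rewrite mxE.
  move: h (norm1_entry (a1 *m N) 0); move: (norm1 _) ((x *m N) 0 0) ((a1 *m N) 0 0) => n u v.
  by lia.
have [g [g0 gw gz gc]] := esc _ hx2.
pose In2 (c : rconf r) := [/\ reachable c, c.1.2 != 0 & connect (edge wf) q0 c.2].
(* A union bound: to visit [x] the robot must return to the stone or reach [x] before. Nothing is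
   claimed once it has returned. *)
pose H (c : rconf r) : R := if `[< In2 c >] then
  Num.min 1 (ret (c.1.2, c.2) + g c.2 (c.1.1 + c.1.2 - a1)) else 1.
have H1 c : H c <= 1 by rewrite /H; case: ifP => _; rewrite ?ge_min ?lexx.
have ret0 c : 0 <= ret c by case/andP: (ret01 c).
have H0 c : 0 <= H c.
  by rewrite /H; case: ifP => _; rewrite ?le_min ler01//= addr_ge0.
have : cover_prob x (s1, y1, q1) <= H (s1, y1, q1).
  apply: (@vlim_comparison _ _ _ _ _ (fun=> True)) => [//|c _|//|[[s' y'] q'] _ _|//].
    move=> /eqP hc; rewrite /H; case: ifP => // _; rewrite le_min lexx /=.
    by rewrite hc; apply: (@le_trans _ _ (g c.2 (x - a1))); rewrite ?gz// lerDr.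
  have avgH1 : avg (@rel_step 5 r) H (s', y', q') <= 1.
    by rewrite /avg; have := H1 (rel_step (s', y', q') false);
      have := H1 (rel_step (s', y', q') true); lra.
  rewrite {2}/H; case: ifPn => // /asboolP[/= h1 yn0 h2]; rewrite le_min avgH1 /=.
  have [rlt|rge] := ltP (ret (y', q')) 1; last first.
    by apply: le_trans avgH1 (le_trans rge _); rewrite lerDl.
  have sccq : scc wf q1 q'.
    have /andP[p1 p2] := comp _ _ _ h1 h2 rlt; have /andP[p3 p4] := scc1.
    by rewrite /scc (connect_trans p4 p1) (connect_trans p2 p3).
  have next b : H (rel_step (s', y', q') b) <= ret (y' + move q', see_trans q' false b) +
     (if scc wf q1 (see_trans q' false b) then
      g (see_trans q' false b) (s' + y' - a1 + move q') else 0).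
    have rs := off_reachable b yn0 h1.
    have -> : rel_step (s', y', q') b = (s', y' + move q', see_trans q' false b).
      by rewrite /= /carried (negbTE yn0) /= subr0 addr0.
    have cs : connect (edge wf) q0 (see_trans q' false b).
      by apply: connect_trans h2 (connect1 _); exact: away_edge.
    (* Outside the component the return is certain, so the term [ret] alone already dominates
       [H]. *)
    have [r1|rl] := eqVneq (ret (y' + move q', see_trans q' false b)) 1.
      by apply: le_trans (H1 _) _; rewrite r1 lerDl; case: ifP.
    have rl' : ret (y' + move q', see_trans q' false b) < 1.
      by rewrite lt_neqAle rl; case/andP: (ret01 (y' + move q', see_trans q' false b)).
    have -> : scc wf q1 (see_trans q' false b).
      have /andP[p1 p2] := comp _ _ _ rs cs rl'; have /andP[p3 p4] := scc1.
      by rewrite /scc (connect_trans p4 p1) (connect_trans p2 p3).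
    rewrite /H; case: asboolP => [_|[]] /=.
      by rewrite ge_min addrA (addrAC (s' + y')) lexx orbT.
    by split=> //=; apply: contra rl => /eqP ->; rewrite ret_met// /met eqxx.
  have := gw q' (s' + y' - a1) sccq.
  rewrite (sum_away_weight q' (scc wf q1) (fun p => g p (s' + y' - a1 + move q'))).
  rewrite (return_prob_step q' yn0) /avg.
  have := next false; have := next true; lra.
rewrite (cov1 x hx1) /H; case: ifPn => [_|/asboolP[]].
  by rewrite le_min lexx /= subrr; lra.
split=> //=.
apply/negP => /eqP y10; move: lt1; rewrite ret_met ?/met ?y10//; lra.
Qed.

End NoCover.

(** * The robot stays near finitely many planes through the stone *)

Section Confinement.
Context {R : realType} (r : robot 5 1).
Local Notation Q := (state r).
Local Notation ret := (@return_prob 5 r R).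
Local Notation wf := (@away_weight 5 r R).
Local Notation reachable := (@reachable 5 r).

Hypothesis cover1 : forall x, @cover_prob 5 r R x (0, 0, init_state r) = 1.

(** A robot farther from the stone than the path is long cannot meet the stone on it, and suitable
    bits make it follow any edges of [away_weight]. *)
Lemma off_path_reachable s y q p : reachable (s, y, q) -> path (edge wf) q p ->
  (size p < norm1 y)%N -> exists y', [/\ reachable (s, y', last q p),
    (norm1 (y' - y) <= size p)%N & y' != 0].
Proof.
elim: p y q => [|q1 p IH] y q hre /=.
  move=> _ y0; exists y; rewrite subrr; split=> //.
    by rewrite /norm1 big1// => i _; rewrite mxE.
  by apply: contraTneq y0 => ->; rewrite /norm1 big1// => i _; rewrite mxE.
move=> /andP[/away_edge_inv[b ->]] hp hsz.
have y0 : y != 0.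
  by apply: contraTneq hsz => ->; rewrite /norm1 big1// => i _; rewrite mxE.
have nm : (norm1 y <= norm1 (y + move q) + 1)%N.
  by have := norm1D (y + move q) (- move q); rewrite addrK norm1N norm1_move.
have [] := IH _ _ (off_reachable b y0 hre) hp.
  by rewrite addn1 in nm; rewrite -ltnS; exact: leq_trans hsz nm.
move=> y' [h1 h2 h3]; exists y'; split=> //.
have -> : y' - y = y' - (y + move q) + move q by rewrite opprD addrA subrK.
apply: leq_trans (norm1D _ _) _; rewrite norm1_move addn1 ltnS.
exact: h2.
Qed.

(** From a large offset a terminal state [c] is attained in fewer than [#|Q|] steps, and [c] selects
    the plane, the kernel of [M c]. If the offset were then far from it, the stone would be met
    again with probability at most 1/2, against [return_prob1]. [B] also pays for the steps leading
    to [c]. *)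
Lemma offsets_confined : exists (M : Q -> 'M[int]_(5, 3)) (B : nat),
  (forall c (t : 'cV_3), M c *m t = 0 -> t = 0) /\
  forall s y q, reachable (s, y, q) -> exists c, forall j,
    (`|(y *m M c) 0%R j| <= B)%N.
Proof.
have e0 : 0 < 2^-1 :> R by lra.
have /choice[M /choice[BM hM]] := fun c => @scc_escape R Q wf (@away_weight_ge0 _ r R)
  (@away_weight_sum _ r R) 3 (@move _ _ r) c _ e0.
have /choice[C hC] := fun c => mulmx_norm1_bound (M c).
pose B := (\sum_c (BM c + #|Q| * C c))%N.
have leB c : (BM c + #|Q| * C c <= B)%N by rewrite /B (bigD1 c)//= leq_addr.
exists M, B; split=> [c|s y q hre]; first by case: (hM c).
have [small|large] := leqP (norm1 y) #|Q|.
  exists q => j; apply: leq_trans (hC q y j) (leq_trans _ (leB q)).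
  by apply: leq_trans (leq_addl _ _); rewrite leq_mul2r small orbT.
have [c [/connectP[p hp hlast] term]] := exists_terminal_state wf q.
move: hlast; case/shortenP: hp => p' hp' up' _ hlast.
have szp : (size p' < #|Q|)%N.
  by have := card_uniqP up' => /= <-; exact: max_card.
have [y' [re' dist y'0]] := off_path_reachable hre hp' (ltn_trans szp large).
rewrite -hlast in re'.
have [injM esc] := hM c.
suff conf j : (`|(y' *m M c) 0%R j| <= BM c)%N.
  exists c => j; apply: leq_trans (leB c).
  have -> : (y *m M c) 0 j = (y' *m M c) 0 j - ((y' - y) *m M c) 0 j.
    by rewrite mulmxBl [X in _ = _ - X]mxE [X in _ = _ - (_ + X)]mxE; ring.
  have h1 : (`|((y' - y) *m M c) 0%R j| <= #|Q| * C c)%N.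
    apply: leq_trans (hC c _ j) _; rewrite leq_mul2r (leq_trans dist) ?orbT//.
    exact: ltnW.
  move: (conf j) h1; move: (BM c) (#|Q| * C c)%N ((y' *m M c) 0 j) (((y' - y) *m M c) 0 j).
  by move=> n1 n2 u v; lia.
rewrite leqNgt; apply/negP => big.
(* Meeting the stone amounts to a displacement by [- y']. *)
have [|g [g0 gw gz gc]] := esc (- y').
  by exists j; rewrite mulNmx mxE abszN.
pose H (a : cell 5 * Q) := g a.2 (a.1 - y').
have : ret (y', c) <= H (y', c).
  apply: (@vlim_comparison _ _ _ _ _ (fun a => connect (edge wf) c a.2)) => [[a q1] _|[a q1] _|[a q1] b|[a q1]|].
  - exact: g0.
  - by move=> /eqP /= ->; rewrite /H /= sub0r gz.
  - move=> /= cq _; apply: connect_trans cq (connect1 _); exact: away_edge.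
  - move=> /= cq _.
    have sc b : connect (edge wf) c q1 -> scc wf c (see_trans q1 false b).
      move=> cq1; have h : connect (edge wf) c (see_trans q1 false b).
        by apply: connect_trans cq1 (connect1 _); exact: away_edge.
      by rewrite /scc h term.
    have sq : scc wf c q1 by rewrite /scc cq term.
    have := gw q1 (a - y') sq.
    rewrite (sum_away_weight q1 (scc wf c) (fun p => g p (a - y' + move q1))) !sc//.
    by rewrite /avg /H /= (addrAC a).
  - exact: connect0.
rewrite (return_prob1 cover1 re') /H /= subrr; lra.
Qed.

End Confinement.

(** * The walk of the stone between meetings misses a generic cell *)

Section StoneWalk.
Context {R : realType} (r : robot 5 1).
Local Notation Q := (state r).
Local Notation law := (@return_law 5 r R).
Local Notation reachable := (@reachable 5 r).

(* The law of the state at the next meeting of robot and stone, from the state at a meeting. *)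
Definition meeting_weight (q q' : Q) : R :=
  (law q' (move q - carried 0 q, see_trans q true false) +
   law q' (move q - carried 0 q, see_trans q true true)) / 2.

Local Notation ws := meeting_weight.

Lemma meeting_weight_ge0 q q' : 0 <= ws q q'.
Proof. by rewrite divr_ge0// addr_ge0// return_law_ge0. Qed.

Lemma meeting_weight_sum q : \sum_q' ws q q' <= 1.
Proof.
rewrite -mulr_suml big_split /=.
have := @return_law_sum _ r R (move q - carried 0 q, see_trans q true false).
have := @return_law_sum _ r R (move q - carried 0 q, see_trans q true true).
lra.
Qed.

Lemma law_edge q q' b : 0 < law q' (move q - carried 0 q, see_trans q true b) ->
  edge ws q q'.
Proof.
move=> h; rewrite /edge divr_gt0//; case: b h => h.
  by rewrite ltr_wpDl// return_law_ge0.
by rewrite ltr_pwDl// return_law_ge0.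
Qed.

(** Otherwise the zero function would pass the comparison for the law of the next meeting, and the
    weight would vanish. *)
Lemma meeting_edge_reachable s q q' : reachable (s, 0, q) -> edge ws q q' ->
  exists s', reachable (s', 0, q').
Proof.
move=> hre he; have [//|none] := pselect (exists s', reachable (s', 0, q')).
have law0 a : (exists s', reachable (s', a.1, a.2)) -> law q' a <= 0.
  apply: (@vlim_comparison _ _ _ _ _ (fun a => exists s', reachable (s', a.1, a.2))
    (fun=> 0)) => [//|[y p] /= [s' h] /eqP /= y0|[y p] b /= [s' h] y0|].
  - case: eqP => [e|_]; last exact: lexx.
    by exfalso; apply: none; exists s'; rewrite -e -y0.
  - by exists s'; exact: off_reachable.
  - by move=> c _ _; rewrite /avg addr0 mul0r.
have law0' b : law q' (move q - carried 0 q, see_trans q true b) <= 0.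
  by apply: law0; exists (s + carried 0 q); exact: met_reachable.
move: he; rewrite /edge /ws; have := law0' false; have := law0' true; lra.
Qed.

Lemma meeting_connect_reachable s q q' : reachable (s, 0, q) ->
  connect (edge ws) q q' -> exists s', reachable (s', 0, q').
Proof.
move=> hre /connectP[p]; elim: p s q hre => [|q1 p IH] s q hre /=.
  by move=> _ ->; exists s.
by move=> /andP[/(meeting_edge_reachable hre)[s' hre']]; exact: IH hre'.
Qed.

Lemma injective_mul_neq0 (M : 'M[int]_(5, 3)) (N : 'M[int]_(3, 1)) :
  (forall t : 'cV_3, M *m t = 0 -> t = 0) ->
  (forall t : 'cV_1, N *m t = 0 -> t = 0) -> M *m N != 0.
Proof.
move=> injM injN; apply/negP => /eqP/injM N0.
have /matrixP/(_ 0 0) := injN 1 (etrans (congr1 (fun A => A *m _) N0) (mul0mx _ _)).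
by rewrite !mxE.
Qed.

(** The vectors with entries from [-B] to [B], indexed by a finite type so that potentials can be
    summed over them. *)
Definition box_point (B : nat) (f : 'rV['I_B.*2.+1]_3) : 'rV[int]_3 :=
  \row_j (Posz (f 0 j) - B%:Z).

Lemma box_pointP B (v : 'rV[int]_3) : (forall j, `|v 0%R j| <= B)%N ->
  exists f, v = @box_point B f.
Proof.
move=> h; exists (\row_j inord (absz (v 0 j + B%:Z))); apply/rowP => j; rewrite !mxE.
have := h j; move: (v 0 j) => a ha; rewrite inordK; lia.
Qed.

(** When the robot is at [x], the projection of the stone by some [M c] takes one of finitely many
    values [z i]. For generic [x] the projected stone walk, in dimension 2 + 1, attains each of them
    with probability at most [eps]; this is chosen to make the union bound 1/2. *)
Lemma not_cover5 : ~ (forall x, @cover_prob 5 r R x (0, 0, init_state r) = 1).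
Proof.
move=> cover1.
have [M [B [injM conf]]] := offsets_confined cover1.
have [q0 [c0 term]] := exists_terminal_state ws (init_state r).
have [s0 re0] := meeting_connect_reachable (reachable_init r) c0.
pose I : finType := (Q * 'rV['I_B.*2.+1]_3)%type.
have cardI : 0 < (#|{: I}|%:R : R).
  by rewrite ltr0n; apply/card_gt0P; exists (q0, 0).
pose eps : R := 2^-1 / #|{: I}|%:R.
have eps0 : 0 < eps by rewrite divr_gt0.
(* The stone moves only in a step that begins at a meeting, so its displacement up to the next
   meeting is determined by the state [q] at this one. *)
pose stone_disp (c q : Q) : 'rV[int]_(2 + 1) := carried 0 q *m M c.
have /choice[N /choice[BN hN]] := fun c => @scc_escape R Q ws meeting_weight_ge0
  meeting_weight_sum 1 (stone_disp c) q0 _ eps0.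
have [B1 cov1] := cover_prob_reachable cover1 re0.
pose s5 : seq 'cV[int]_5 := delta_mx 0 0 :: [seq M c *m N c | c <- enum Q].
pose big := (B1 + \sum_(i : I) (BN i.1 + `|(s0 *m M i.1 *m N i.1) 0%R 0%R|
   + `|(box_point i.2 *m N i.1) 0%R 0%R|))%N.
have [L|x hx] := @generic_cell 5 s5 big.
  rewrite inE => /orP[/eqP ->|/mapP[c _ ->]].
    by apply/negP => /eqP/matrixP/(_ 0 0); rewrite !mxE.
  by apply: injective_mul_neq0; [exact: injM|case: (hN c)].
have hx1 : (B1 < norm1 x)%N.
  have := hx (delta_mx 0 0); rewrite inE eqxx => /(_ isT).
  rewrite -colE mxE => h; apply: leq_trans (norm1_entry x 0).
  by apply: leq_ltn_trans h; rewrite leq_addr.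
pose z (i : I) : 'rV[int]_(2 + 1) := (x - s0) *m M i.1 - box_point i.2.
have hz i : exists j, (BN i.1 < `|(z i *m N i.1) 0%R j|)%N.
  have mem : M i.1 *m N i.1 \in s5.
    by rewrite inE; apply/orP; right; apply/mapP; exists i.1; rewrite ?mem_enum.
  exists 0; have := hx _ mem; rewrite mulmxA.
  have -> : (z i *m N i.1) 0 0 = (x *m M i.1 *m N i.1) 0 0 - (s0 *m M i.1 *m N i.1) 0 0
     - (box_point i.2 *m N i.1) 0 0.
    by rewrite /z !mulmxBl mxE; congr (_ + _); rewrite mxE //; congr (_ + _); rewrite mxE.
  have key (n m S : nat) (u v t : int) : (m + (n + `|v| + `|t| + S) < `|u|)%N ->
    (n < `|(u - v - t)%R|)%N by lia.
  by rewrite /big (bigD1 i)//=; exact: key.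
have /choice[g hg] := fun i => (hN i.1).2 (z i) (hz i).
pose near s := [exists i : I, (s - s0) *m M i.1 == z i].
(* The potentials are averaged over the state at the next meeting, counting the present moment if
   the robot is on the stone. Off the stone this average is harmonic. *)
pose H0 (c : rconf r) : R := \sum_i \sum_q' law q' (c.1.2, c.2) * g i q' ((c.1.1 - s0) *m M i.1).
pose H (c : rconf r) : R := if near c.1.1 then 1 else Num.min 1 (H0 c).
have H0_ge0 c : 0 <= H0 c.
  apply: sumr_ge0 => i _; apply: sumr_ge0 => q' _; rewrite mulr_ge0 ?return_law_ge0//.
  by case: (hg i).
have H_le1 c : H c <= 1 by rewrite /H; case: ifP => _; rewrite ?ge_min lexx.
have avgH1 c : avg (@rel_step 5 r) H c <= 1.
  by rewrite /avg; have := H_le1 (rel_step c false); have := H_le1 (rel_step c true); lra.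
have H0met s q : H0 (s, 0, q) = \sum_i g i q ((s - s0) *m M i.1).
  apply: eq_bigr => i _; rewrite (bigD1 q)//= return_law0 eqxx mul1r big1 ?addr0//.
  by move=> q' /negbTE; rewrite return_law0 eq_sym => ->; rewrite mul0r.
have H_le_H0 s y q : (near s -> y = 0) -> H (s, y, q) <= H0 (s, y, q).
  rewrite {1}/H /=; case: ifPn => [ns /(_ isT) ->|_ _]; last by rewrite ge_min lexx orbT.
  have /existsP[i /eqP ei] := ns; rewrite H0met (bigD1 i)//= ei.
  have [g0 _ gz _] := hg i; apply: le_trans (gz q) _; rewrite lerDl.
  by apply: sumr_ge0 => j _; case: (hg j).
(* [q0] is terminal, so all later meetings happen in its component, where the potentials are
   superharmonic. *)
pose Inv (c : rconf r) := reachable c /\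
  forall q', 0 < law q' (c.1.2, c.2) -> scc ws q0 q'.
have : cover_prob x (s0, 0, q0) <= H (s0, 0, q0).
  apply: (@vlim_comparison _ _ _ _ _ Inv) => [c _|[[s y] q] [hre hs]|[[s y] q] b [hre hs] _|[[s y] q] [hre hs] _|].
  - by rewrite /H; case: ifP => _; rewrite ?le_min ler01//= H0_ge0.
  - move=> /eqP /= hxy; have [c hc] := conf _ _ _ hre.
    have [f ef] := box_pointP hc.
    rewrite /H /=; case: ifPn => // /existsP[]; exists (c, f).
    by rewrite /z /= -ef -hxy -mulmxBl; apply/eqP; congr (_ *m _); rewrite addrAC addrK.
  - split; first exact: reachable_step.
    move=> q' /=; have [y0|y0] := eqVneq y 0.
      rewrite y0 add0r => /law_edge he.
      have /andP[h1 h2] : scc ws q0 q by apply: hs; rewrite /= y0 return_law0 eqxx ltr01.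
      have h3 : connect (edge ws) q0 q' by apply: connect_trans h1 (connect1 he).
      by rewrite /scc h3 term.
    rewrite /carried (negbTE y0) /= subr0 => hl; apply: hs.
    rewrite /= return_law_step// divr_gt0//; case: b hl => hl.
      by rewrite ltr_wpDl// return_law_ge0.
    by rewrite ltr_pwDl// return_law_ge0.
  - rewrite {2}/H /=; case: ifPn => nns; first exact: avgH1.
    rewrite le_min avgH1 /=.
    (* The stone moves only together with the robot, so a step that brings it near leaves the robot
       on it, where [H0] is at least 1. *)
    have step_le b : H (rel_step (s, y, q) b) <= H0 (rel_step (s, y, q) b).
      apply: H_le_H0; rewrite /carried; case: ifP => [/andP[/eqP -> _] _|_].
        by rewrite add0r subrr.
      by rewrite addr0 (negbTE nns).
    apply: (@le_trans _ _ (avg (@rel_step 5 r) H0 (s, y, q))).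
      by apply: avg_le => b; exact: step_le.
    have [y0|y0] := eqVneq y 0.
      have sq : scc ws q0 q by apply: hs; rewrite /= y0 return_law0 eqxx ltr01.
      have -> : avg (@rel_step 5 r) H0 (s, y, q) =
          \sum_i \sum_q' ws q q' * g i q' ((s - s0) *m M i.1 + stone_disp i.1 q).
        rewrite /avg /H0 /= y0 eqxx add0r -big_split mulr_suml.
        apply: eq_bigr => i _ /=; rewrite -big_split mulr_suml; apply: eq_bigr => q' _ /=.
        rewrite /stone_disp -mulmxDl (addrAC s) /ws.
        by field.
      rewrite y0 H0met; apply: ler_sum => i _.
      have [_ gw _ _] := hg i; apply: le_trans (gw q _ sq).
      rewrite [leRHS]big_mkcond /=; apply: ler_sum => q' _.
      case: ifPn => // nq; have [->|w0] := eqVneq (ws q q') 0; first by rewrite mul0r.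
      have /andP[h1 h2] := sq.
      have he : edge ws q q' by rewrite /edge lt_neqAle eq_sym w0 meeting_weight_ge0.
      have h3 : connect (edge ws) q0 q' by apply: connect_trans h1 (connect1 he).
      by rewrite /scc h3 term in nq.
    rewrite /avg /H0 /= /carried (negbTE y0) /= subr0 addr0 -big_split mulr_suml.
    apply: ler_sum => i _ /=; rewrite -big_split mulr_suml; apply: ler_sum => q' _ /=.
    by rewrite (return_law_step q' q y0) -mulrDl mulrAC lexx.
  - split=> // q' /=; rewrite return_law0; case: eqP => [<- _|_]; last by rewrite ltxx.
    exact: scc_refl.
rewrite (cov1 x hx1) /H /=; case: ifPn => [/existsP[i /eqP]|_].
  rewrite subrr mul0mx => e; have [j] := hz i.
  by rewrite -e mul0mx mxE.
rewrite le_min lexx /= H0met => hle.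
have : \sum_i g i q0 ((s0 - s0) *m M i.1) <= \sum_(i : I) eps.
  by apply: ler_sum => i _; rewrite subrr mul0mx; case: (hg i).
rewrite sumr_const -[_ *+ _]mulr_natr /eps divfK ?gt_eqF//; lra.
Qed.

End StoneWalk.

(** * Probability spaces carrying fair bits *)

Section BitEvents.
Context {R : realType} {d : measure_display} {T : measurableType d}.
Variables (P : probability T R) (xi : nat -> T -> bool).
Hypothesis mxi : forall j (B : set bool), measurable (xi j @^-1` B).

Definition cylinder (b : seq bool) : set T :=
  [set t | forall j, (j < size b)%N -> xi j t = nth false b j].

Lemma cylinder_rcons b c :
  cylinder (rcons b c) = cylinder b `&` xi (size b) @^-1` [set c].
Proof.
apply/seteqP; split=> [t ht|t [ht hc] j] /=.
  split=> [j hj|]; last by have := ht (size b); rewrite size_rcons ltnSn nth_rcons ltnn eqxx; exact.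
  by have := ht j; rewrite size_rcons (leqW hj) nth_rcons hj; exact.
rewrite size_rcons ltnS leq_eqVlt nth_rcons => /orP[/eqP ->|hj].
  by rewrite ltnn eqxx.
by rewrite hj; exact: ht.
Qed.

Lemma measurable_cylinder b : measurable (cylinder b).
Proof.
elim/last_ind: b => [|b c IH]; last by rewrite cylinder_rcons; apply: measurableI.
rewrite (_ : cylinder [::] = setT); first exact: measurableT.
by apply/seteqP; split.
Qed.

Hypothesis Pcylinder : forall b, P (cylinder b) = (2^-1 ^+ size b)%:E.

Section Event.
Context {X : Type} (stp : X -> bool -> X) (S : pred X).

(* Starting from [c], with the bits numbered from [n], [S] is visited within [m] steps. *)
Fixpoint visit_event (m : nat) (c : X) (n : nat) : set T :=
  if S c then setT else if m is m'.+1 then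
    (xi n @^-1` [set false] `&` visit_event m' (stp c false) n.+1) `|`
    (xi n @^-1` [set true] `&` visit_event m' (stp c true) n.+1)
  else set0.

Lemma measurable_visit_event m c n : measurable (visit_event m c n).
Proof.
elim: m c n => [|m IH] c n /=; case: ifP => _ //.
by apply: measurableU; apply: measurableI.
Qed.

(** Keeping the prefix [b] of bits already read replaces conditioning: the induction uses nothing
    but the probabilities of cylinders. *)
Lemma prob_cylinder_visit m c b : P (cylinder b `&` visit_event m c (size b)) =
  (2^-1 ^+ size b * val stp S (fun=> 1) m c)%:E.
Proof.
elim: m c b => [|m IH] c b /=; case: ifP => _.
- by rewrite setIT mulr1 Pcylinder.
- by rewrite setI0 measure0 mulr0.
- by rewrite setIT mulr1 Pcylinder.
have IH' c' b' : P (cylinder (rcons b b') `&` visit_event m c' (size b).+1) =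
    (2^-1 ^+ (size b).+1 * val stp S (fun=> 1) m c')%:E.
  by have := IH c' (rcons b b'); rewrite size_rcons.
rewrite setIUr !setIA -!cylinder_rcons measureU.
- pose v c' : R := 2^-1 ^+ (size b).+1 * val stp S (fun=> 1) m c'.
  transitivity ((v (stp c false))%:E + (v (stp c true))%:E)%E.
    by congr (_ + _)%E; exact: IH'.
  by rewrite /v /avg -EFinD exprS; congr (_%:E); field.
- by apply: measurableI; [exact: measurable_cylinder|exact: measurable_visit_event].
- by apply: measurableI; [exact: measurable_cylinder|exact: measurable_visit_event].
- apply/seteqP; split=> // t [[]]; rewrite !cylinder_rcons /= => -[_ h1] _ [[_ h2] _].
  by move: h1; rewrite h2.
Qed.

Lemma prob_visit_event m c : P (visit_event m c 0) = (val stp S (fun=> 1) m c)%:E.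
Proof.
have := prob_cylinder_visit m c [::].
rewrite expr0 mul1r (_ : cylinder [::] = setT) ?setTI//.
by apply/seteqP; split.
Qed.

Fixpoint follow (bits : nat -> bool) (c : X) (m : nat) : X :=
  if m is m'.+1 then stp (follow bits c m') (bits m') else c.

Lemma follow_shift bits c m :
  follow bits c m.+1 = follow (bits \o succn) (stp c (bits 0%N)) m.
Proof. by elim: m => [//|m IH]; rewrite [LHS]/= -/(follow _ _ m.+1) IH. Qed.

Lemma visit_eventP m c n t : visit_event m c n t <->
  exists2 i, (i <= m)%N & S (follow (fun j => xi (n + j) t) c i).
Proof.
elim: m c n => [|m IH] c n /=; case: ifPn => Sc.
- by split=> // _; exists 0%N.
- by split=> // -[i]; rewrite leqn0 => /eqP ->; apply/negP.
- by split=> // _; exists 0%N.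
have e b : (exists2 i, (i <= m)%N & S (follow (fun j => xi (n.+1 + j) t) (stp c b) i)) ->
    xi n t = b -> exists2 i, (i <= m.+1)%N & S (follow (fun j => xi (n + j) t) c i).
  move=> [i im Si] hb; exists i.+1 => //; rewrite follow_shift addn0 hb.
  rewrite (_ : _ \o _ = fun j => xi (n.+1 + j) t)//.
  by apply/funext => j; rewrite /= addnS addSn.
split=> [[[h1 /IH h2]|[h1 /IH h2]]|[[|i] im]].
- exact: e h2 h1.
- exact: e h2 h1.
- by move=> /= Sc'; rewrite Sc' in Sc.
- rewrite follow_shift addn0 (_ : _ \o _ = fun j => xi (n.+1 + j) t); last first.
    by apply/funext => j; rewrite /= addnS addSn.
  move=> Si; case hb: (xi n t) Si => Si; [right|left]; split=> //; apply/IH; by exists i.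
Qed.

Lemma prob_visit c : P [set t | exists m, S (follow (xi ^~ t) c m)] =
  (vlim stp S (fun=> 1) c)%:E.
Proof.
have -> : [set t | exists m, S (follow (xi ^~ t) c m)] =
    \bigcup_m visit_event m c 0.
  apply/seteqP; split=> t /=.
    by move=> [m Sm]; exists m => //; apply/visit_eventP; exists m.
  by move=> [m _ /visit_eventP[i _ Si]]; exists i.
have cv : P \o (fun m => visit_event m c 0) @ \oo --> P (\bigcup_m visit_event m c 0).
  apply: nondecreasing_cvg_mu.
  - by move=> m; exact: measurable_visit_event.
  - by apply: bigcupT_measurable => m; exact: measurable_visit_event.
  - move=> m n mn; apply/subsetPset => t /visit_eventP[i im Si]; apply/visit_eventP.
    by exists i => //; exact: leq_trans mn.
have cv2 : P \o (fun m => visit_event m c 0) @ \oo --> (vlim stp S (fun=> 1) c)%:E.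
  rewrite (_ : P \o _ = EFin \o (fun m => val stp S (fun=> 1) m c)); last first.
    by apply/funext => m; rewrite /= prob_visit_event.
  by apply: cvg_EFin; [near=> n|apply: val_cvg => c'; exact: one01].
exact: (cvg_unique _ cv cv2).
Unshelve. all: end_near. Qed.

End Event.
End BitEvents.

Section FairBits.
Context {R : realType}.

Lemma fair_bits_cylinder d (T : measurableType d) (P : probability T R)
    (xi : nat -> {RV P >-> bool}) : fair_bits xi ->
  forall b, P (cylinder (fun j => xi j) b) = (2^-1 ^+ size b)%:E.
Proof.
move=> [half ind] b.
have := ind (iota 0 (size b)) (fun j => [set nth false b j]) (iota_uniq _ _).
have -> : \bigcap_(j in [set` iota 0 (size b)]) (xi j @^-1` [set nth false b j]) =
    cylinder (fun j => xi j) b.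
  apply/seteqP; split=> t ht j /=.
    by move=> hj; apply: ht; rewrite /= mem_iota.
  by rewrite mem_iota /= add0n => hj; exact: ht.
move=> ->; rewrite (eq_bigr (fun=> (2^-1 : R)%:E)) => [|j _]; last exact: half.
by rewrite prodEFin big_const_seq count_predT size_iota iter_mulr_1.
Qed.

Lemma measurable_bit d (T : measurableType d) (P : probability T R)
  (xi : nat -> {RV P >-> bool}) j (B : set bool) : measurable (xi j @^-1` B).
Proof. exact: measurable_funPTI. Qed.

Section IndependenceFromCylinders.
Context {d : measure_display} {T : measurableType d}.
Variables (P : probability T R) (xi : nat -> T -> bool).
Hypothesis mxi : forall j (B : set bool), measurable (xi j @^-1` B).
Hypothesis Pcylinder : forall b, P (cylinder xi b) = (2^-1 ^+ size b)%:E.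

Definition bit_mass (B : set bool) : R := ((false \in B)%:R + (true \in B)%:R) / 2.

(* A walk that counts the bits as long as the [n]-th one belongs to [B n]. *)
Definition test_step (B : nat -> set bool) (c : option nat) (b : bool) : option nat :=
  if c is Some n then (if b \in B n then Some n.+1 else None) else None.

Lemma val_test B N n m : (n + m)%N = N ->
  val (test_step B) (pred1 (Some N)) (fun=> 1 : R) m (Some n) =
  \prod_(n <= j < N) bit_mass (B j).
Proof.
have none k : val (test_step B) (pred1 (Some N)) (fun=> 1 : R) k None = 0.
  by elim: k => [//|k IH] /=; rewrite /avg /= IH addr0 mul0r.
elim: m n => [|m IH] n; first by rewrite addn0 => ->; rewrite /= eqxx big_geq.
move=> e; have nN : (n < N)%N by rewrite -e addnS ltnS leq_addr.
rewrite /= (_ : Some n == Some N = false); last first.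
  by apply/negbTE/negP => /eqP[en]; rewrite en ltnn in nN.
rewrite big_ltn// -IH ?addSnnS// /avg /= /bit_mass.
by case: (false \in B n); case: (true \in B n); rewrite ?none /nat_of_bool; field.
Qed.

Lemma test_visit_event B N n m : (n + m)%N = N ->
  visit_event xi (test_step B) (pred1 (Some N)) m (Some n) n =
  [set t | forall j, (n <= j < N)%N -> xi j t \in B j].
Proof.
have none k n' : visit_event xi (test_step B) (pred1 (Some N)) k None n' = set0.
  by elim: k n' => [//|k IH] n' /=; rewrite !IH !setI0 setU0.
elim: m n => [|m IH] n.
  rewrite addn0 => ->; rewrite /= eqxx; apply/seteqP; split=> // t _ j.
  by case: leqP => //= h1 h2; have := leq_trans h2 h1; rewrite ltnn.
move=> e; have nN : (n < N)%N by rewrite -e addnS ltnS leq_addr.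
rewrite /= (_ : Some n == Some N = false); last first.
  by apply/negbTE/negP => /eqP[en]; rewrite en ltnn in nN.
have branch b : visit_event xi (test_step B) (pred1 (Some N)) m
    (if b \in B n then Some n.+1 else None) n.+1 =
    [set t | b \in B n /\ forall j, (n < j < N)%N -> xi j t \in B j].
  case: ifPn => hb; last by rewrite none; apply/seteqP; split=> // t [].
  rewrite IH ?addSnnS//; apply/seteqP; split=> [t h|t []] //.
rewrite !branch; apply/seteqP; split=> t.
  move=> [[/= ht [h1 h2]]|[/= ht [h1 h2]]] j /andP[]; rewrite leq_eqVlt => /orP[/eqP <- _|h3 h4].
  - by rewrite ht.
  - by apply: h2; rewrite h3.
  - by rewrite ht.
  - by apply: h2; rewrite h3.
move=> ht; have hn : xi n t \in B n by apply: ht; rewrite leqnn nN.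
have h2 j : (n < j < N)%N -> xi j t \in B j.
  by move=> /andP[h3 h4]; apply: ht; rewrite (ltnW h3) h4.
by case hb: (xi n t) hn => hn; [right|left].
Qed.

(** With trivial tests outside [J], the event is that the walk of [test_step] survives [N] bits; its
    probability is a [val], which factorizes. *)
Lemma prob_bits (J : seq nat) (B : nat -> set bool) : uniq J ->
  P (\bigcap_(j in [set` J]) (xi j @^-1` B j)) = (\prod_(j <- J) bit_mass (B j))%:E.
Proof.
move=> uJ; pose N := (\max_(j <- J) j).+1.
have JN j : j \in J -> (j < N)%N by move=> jJ; rewrite ltnS leq_bigmax_seq.
pose B' j := if j \in J then B j else setT.
have -> : \bigcap_(j in [set` J]) (xi j @^-1` B j) =
    visit_event xi (test_step B') (pred1 (Some N)) N (Some 0%N) 0.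
  rewrite test_visit_event//; apply/seteqP; split=> t ht j.
    rewrite /B' => _; case: ifP => jJ; last by rewrite in_setT.
    by apply/mem_set; exact: ht.
  move=> jJ; have := ht j (JN j jJ); rewrite /B' [j \in J]jJ => /set_mem; exact.
rewrite (prob_visit_event mxi Pcylinder) val_test//; congr (_%:E).
rewrite (bigID (fun j => j \in J)) /= [X in _ * X]big1 ?mulr1; last first.
  by move=> j /negbTE jJ; rewrite /B' jJ /bit_mass !in_setT /nat_of_bool; field.
have pJ : perm_eq [seq j <- index_iota 0 N | j \in J] J.
  apply: uniq_perm => [||j]; rewrite ?filter_uniq ?iota_uniq//.
  by rewrite mem_filter mem_index_iota /=; case jJ: (j \in J) => //=; rewrite JN.
rewrite -big_filter (perm_big _ pJ) /=.
by apply: eq_big_seq => j jJ; rewrite /B' jJ.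
Qed.

End IndependenceFromCylinders.

Lemma prob_visits k (r : robot k 1) d (T : measurableType d) (P : probability T R)
    (xi : nat -> {RV P >-> bool}) (x : cell k) : fair_bits xi ->
  P [set t | visits r set0 (fun j => xi j t) x] =
  (cover_prob x (0, 0, init_state r))%:E.
Proof.
move=> fair.
rewrite -(prob_visit (@measurable_bit _ _ _ xi) (fair_bits_cylinder fair)).
pose rel (c : config k 1 (state r)) : rconf r :=
  (tnth (stone_pos c) ord0, robot_pos c - tnth (stone_pos c) ord0, cur_state c).
have relS bits c : rel (step set0 bits c) = rel_step (rel c) (bits (step_number c).-1).
  case: c => a s t q; rewrite /rel /= tnth_mktuple -/(carries q) subr_eq0.
  have -> : observation set0 a s (bits t.-1) =
      cat_tuple [tuple tnth s ord0 == a] [tuple false; bits t.-1].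
    apply: val_inj; rewrite /= (_ : (a \in set0) = false) ?in_set0//.
    by rewrite enum_ordSl enum_ord0.
  rewrite /see_trans /carried subr_eq0 (eq_sym a) andbC.
  case: ifP => h; first by rewrite opprD addrACA.
  by rewrite addr0 subr0 addrAC.
have runS bits m : step_number (run r set0 bits m) = m.+1.
  by elim: m => [//|m IH]; rewrite /run iterS -/(run _ _ _ m); case: (run _ _ _ m) IH => /= ? ? ? ? ->.
have rel_run bits m : rel (run r set0 bits m) = follow (@rel_step k r) bits (0, 0, init_state r) m.
  elim: m => [|m IH]; first by rewrite /rel /= tnth_mktuple subrr.
  by rewrite /run iterS -/(run _ _ _ m) relS IH runS.
congr (P _); apply/seteqP; split=> t [m hm]; exists m; move: hm; rewrite -rel_run /hits /rel /= subrKC.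
  by move=> ->.
by move=> /eqP.
Qed.

End FairBits.

(** * Binary digits of a uniform point as fair bits *)

Section BinaryDigits.
Context {R : realType}.

Definition doubling (w : R) : R := if w < 2^-1 then 2 * w else 2 * w - 1.

Definition binary_digit (j : nat) (w : R) : bool := 2^-1 <= iter j doubling w.

Lemma measurable_binary_digit j :
  measurable_fun [set: measurableTypeR R] (binary_digit j).
Proof.
apply: measurable_fun_ler; first exact: measurable_cst.
elim: j => [|j IH]; first exact: measurable_id.
apply: measurable_fun_ifT; first by apply: measurable_fun_ltr => //; exact: measurable_cst.
  by apply: measurable_funM => //; exact: measurable_cst.
apply: measurable_funB; last exact: measurable_cst.
by apply: measurable_funM => //; exact: measurable_cst.
Qed.

Let mfun_digit (j : nat) :
  @measurable_fun _ _ (measurableTypeR R) bool setT (binary_digit j) :=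
  measurable_binary_digit j.

Definition digit_variable (j : nat) : {RV (uniform_prob (@ltr01 R)) >-> bool} :=
  @mfun_Sub _ _ (measurableTypeR R) bool _ (mem_set (mfun_digit j)).

(** Prepending a digit pulls a dyadic interval back along one branch of the doubling map. The
    cylinder is only squeezed between the open and the closed interval, which have equal measure. *)
Lemma digit_cylinder_interval b : exists u : R,
  [/\ 0 <= u, u + 2^-1 ^+ size b <= 1,
    `]u, u + 2^-1 ^+ size b[%classic `<=` cylinder binary_digit b &
    cylinder binary_digit b `&` `[0, 1] `<=` `[u, u + 2^-1 ^+ size b]%classic].
Proof.
elim: b => [|c b [u [u0 u1 lo hi]]].
  by exists 0; rewrite expr0 add0r lexx; split=> // t [].
set h := 2^-1 ^+ size b in u1 lo hi *.
have h0 : 0 <= h by rewrite exprn_ge0.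
have cylE w : cylinder binary_digit (c :: b) w <->
    binary_digit 0 w = c /\ cylinder binary_digit b (doubling w).
  split=> [hw|[hw0 hw1] [|j] //].
    split; first exact: (hw 0%N).
    by move=> j hj; have := hw j.+1 hj; rewrite /binary_digit iterSr.
  by move=> hj; have := hw1 j hj; rewrite /binary_digit -iterSr.
have sz : 2^-1 ^+ size (c :: b) = h / 2 by rewrite /= exprSr.
rewrite {}sz; case: c cylE => cylE.
- exists ((u + 1) / 2); split; [lra|lra| |] => w.
  + rewrite /= in_itv /= => /andP[w1 w2]; apply/cylE.
    have w3 : 2^-1 <= w by lra.
    split; first by rewrite /binary_digit /= w3.
    apply: lo; rewrite /doubling ltNge w3 /= in_itv /=; lra.
  + move=> [/cylE[]]; rewrite /binary_digit /= => w3 cw; rewrite !in_itv /= => /andP[w1 w2].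
    have : `[u, u + h]%classic (doubling w).
      apply: hi; split=> //; rewrite /doubling ltNge w3 /= in_itv /=; lra.
    rewrite /doubling ltNge w3 /= in_itv /=; lra.
- exists (u / 2); split; [lra|lra| |] => w.
  + rewrite /= in_itv /= => /andP[w1 w2]; apply/cylE.
    have w3 : w < 2^-1 by lra.
    split; first by rewrite /binary_digit /= leNgt w3.
    apply: lo; rewrite /doubling w3 /= in_itv /=; lra.
  + move=> [/cylE[]]; rewrite /binary_digit /= => /negbT; rewrite -ltNge => w3 cw.
    rewrite !in_itv /= => /andP[w1 w2].
    have : `[u, u + h]%classic (doubling w).
      apply: hi; split=> //; rewrite /doubling w3 /= in_itv /=; lra.
    rewrite /doubling w3 /= in_itv /=; lra.
Qed.

Lemma digit_cylinder_prob b :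
  uniform_prob (@ltr01 R) (cylinder binary_digit b) = (2^-1 ^+ size b)%:E.
Proof.
have [u [u0 u1 lo hi]] := digit_cylinder_interval b.
set h := 2^-1 ^+ size b in u1 lo hi *.
have h0 : 0 < h by rewrite exprn_gt0.
have mC : measurable (cylinder binary_digit b : set (measurableTypeR R)).
  apply: measurable_cylinder => j B.
  by rewrite -[X in measurable X]setTI; exact: measurable_binary_digit.
have mI : measurable (cylinder binary_digit b `&` `[0, 1] : set (measurableTypeR R)).
  exact: measurableI.
rewrite /uniform_prob integral_uniform_pdf.
under eq_integral => w.
  rewrite inE => -[_]; rewrite /= in_itv /= => w01.
  rewrite /uniform_pdf w01 subr0 invr1; over.
rewrite integral_cst//= mul1e; apply/eqP; rewrite eq_le; apply/andP; split.
  apply: (@le_trans _ _ (lebesgue_measure (`[u, u + h]%classic : set R))).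
    by apply: le_measure => //; rewrite inE.
  by rewrite lebesgue_measure_itv /= lte_fin ltrDl h0 -EFinB addrAC subrr add0r.
apply: (@le_trans _ _ (lebesgue_measure (`]u, (u + h)[%classic : set R))).
  by rewrite lebesgue_measure_itv /= lte_fin ltrDl h0 -EFinB addrAC subrr add0r.
apply: le_measure; rewrite ?inE// => w hw; split; first exact: lo.
by move: hw; rewrite /= !in_itv /=; lra.
Qed.

(** [covers] quantifies over all spaces with fair bits and would hold vacuously if there were none,
    so the impossibility in Z^5 needs an instance. *)
Lemma exists_fair_bits : exists (d : measure_display) (T : measurableType d)
  (P : probability T R) (xi : nat -> {RV P >-> bool}), fair_bits xi.
Proof.
exists _, (measurableTypeR R), (uniform_prob (@ltr01 R)).
exists digit_variable.
have mxi j (B : set bool) : measurable (binary_digit j @^-1` B : set (measurableTypeR R)).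
  by rewrite -[X in measurable X]setTI; exact: measurable_binary_digit.
have bits := prob_bits mxi digit_cylinder_prob.
have bit1 j B : uniform_prob (@ltr01 R) (binary_digit j @^-1` B) = (bit_mass B)%:E.
  have := bits [:: j] (fun=> B) isT; rewrite big_seq1.
  rewrite (_ : \bigcap_(i in _) _ = binary_digit j @^-1` B)//.
  apply/seteqP; split=> t; first by move=> /(_ j); apply; rewrite /= inE.
  by move=> ht i; rewrite /= inE => /eqP ->.
split=> [j b|J B uJ].
  rewrite [LHS]bit1 /bit_mass; congr (_%:E).
  by case: b; rewrite !in_set1 /= ?add0r ?addr0 mul1r.
rewrite [LHS]bits// -prodEFin; apply: eq_bigr => j _; exact/esym/bit1.
Qed.

End BinaryDigits.

Lemma covers1P (R : realType) k (r : robot k 1) :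
  covers R r set0 <-> forall x, cover_prob x (0, 0, init_state r) = 1 :> R.
Proof.
split=> [cov x|cov d T P xi fair x]; last by rewrite prob_visits// cov.
have [d [T [P [xi fair]]]] := exists_fair_bits (R := R).
by have := cov d T P xi fair x; rewrite prob_visits// => -[].
Qed.

(** * Recurrence of the plane walk *)

Section RecurrentPlane.
Context {R : realType}.

(* [ln (barrier n)] with [n = i ^ 2 + j ^ 2] is superharmonic for the simple random
   walk off the origin; the values at [0] and [1] make this true near the origin
   as well. *)
Definition barrier (n : int) : R :=
  if n == 0 then 1 else if n == 1 then 192 else 768 * (n%:~R - 1).

Lemma barrier0 : barrier 0 = 1. Proof. by []. Qed.
Lemma barrier1 : barrier 1 = 192. Proof. by []. Qed.

Lemma barrierE n : 2 <= n -> barrier n = 768 * (n%:~R - 1).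
Proof. by move=> h; rewrite /barrier; case: eqP => [|_]; [lia|case: eqP => //; lia]. Qed.

Lemma barrier_ge1 n : 0 <= n -> 1 <= barrier n.
Proof.
move=> n0; have [->|h0] := eqVneq n 0; first by rewrite barrier0.
have [->|h1] := eqVneq n 1; first by rewrite barrier1; lra.
have n2 : 2 <= n by lia.
rewrite barrierE//; have : 2 <= n%:~R :> R by rewrite -[2]/(2%:~R) ler_int.
lra.
Qed.

Lemma sum_sqr_ge2 (a b : int) : 2 <= `|a| + `|b| -> 2 <= a * a + b * b.
Proof.
have le_sqr (c : int) : `|c| <= c * c.
  by have [h|h] := leP 0 c; [rewrite ger0_norm//; nia|rewrite ltr0_norm//; nia].
by have := le_sqr a; have := le_sqr b; lia.
Qed.

(** Write B(n) = c(n-1) for n >= 2. At (1,1) the inequality reads B(1) <= c/4, and with B(1) = c/4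
    it reads c >= 768 at (1,0); both are equalities here. Far out it becomes n^4 - 4n^3 + 16a^2b^2
    <= (n-1)^4, where n = a^2 + b^2, which holds since 4a^2b^2 <= n^2 and n >= 2. *)
Lemma barrier_superharmonic (B : int -> R) i j :
  B 0 = 1 -> B 1 = 192 -> (forall n, 2 <= n -> B n = 768 * (n%:~R - 1)) ->
  (i != 0) || (j != 0) ->
  B ((i + 1) * (i + 1) + j * j) * B ((i - 1) * (i - 1) + j * j) *
  (B (i * i + (j + 1) * (j + 1)) * B (i * i + (j - 1) * (j - 1)))
    <= B (i * i + j * j) ^+ 4.
Proof.
move=> B0 B1 BE n0.
have [small|/negP large] := boolP (`|i| + `|j| <= 2).
  have hi : [|| i == -2, i == -1, i == 0, i == 1 | i == 2] by clear -small; lia.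
  have hj : [|| j == -2, j == -1, j == 0, j == 1 | j == 2] by clear -small; lia.
  have [B2 [B4 [B5 B9]]] : B 2 = 768 /\ B 4 = 768 * 3 /\ B 5 = 768 * 4 /\ B 9 = 768 * 8.
    by rewrite !BE//; do !split; lra.
  have k1 : B 4 * B 0 * (B 2 * B 2) <= B 1 ^+ 4 by rewrite B0 B1 B2 B4; lra.
  have k2 : B 0 * B 4 * (B 2 * B 2) <= B 1 ^+ 4 by rewrite (mulrC (B 0)).
  have k3 : B 2 * B 2 * (B 4 * B 0) <= B 1 ^+ 4 by rewrite mulrC.
  have k4 : B 2 * B 2 * (B 0 * B 4) <= B 1 ^+ 4 by rewrite mulrC.
  have l1 : B 5 * B 1 * (B 5 * B 1) <= B 2 ^+ 4 by rewrite B1 B5 B2; lra.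
  have l2 : B 5 * B 1 * (B 1 * B 5) <= B 2 ^+ 4 by rewrite (mulrC (B 1)).
  have l3 : B 1 * B 5 * (B 5 * B 1) <= B 2 ^+ 4 by rewrite (mulrC (B 1)).
  have l4 : B 1 * B 5 * (B 1 * B 5) <= B 2 ^+ 4 by rewrite (mulrC (B 1)).
  have m1 : B 9 * B 1 * (B 5 * B 5) <= B 4 ^+ 4 by rewrite B1 B5 B9 B4; lra.
  have m2 : B 1 * B 9 * (B 5 * B 5) <= B 4 ^+ 4 by rewrite (mulrC (B 1)).
  have m3 : B 5 * B 5 * (B 9 * B 1) <= B 4 ^+ 4 by rewrite mulrC.
  have m4 : B 5 * B 5 * (B 1 * B 9) <= B 4 ^+ 4 by rewrite mulrC.
  (* [done] closes each case by one of the twelve evaluations above. *)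
  move: small n0; case/or4P: hi => [/eqP ->|/eqP ->|/eqP ->|/orP[] /eqP ->];
    case/or4P: hj => [/eqP ->|/eqP ->|/eqP ->|/orP[] /eqP ->] // _ _.
have big a b : 2 <= `|a| + `|b| -> B (a * a + b * b) = 768 * (a%:~R * a%:~R + b%:~R * b%:~R - 1).
  by move=> h; rewrite BE ?rmorphD ?rmorphM// sum_sqr_ge2.
rewrite !big; [|lia..]; rewrite !(intrB R) !(intrD R).
have n2 : 2 <= i%:~R * i%:~R + j%:~R * j%:~R :> R.
  by rewrite -!rmorphM -rmorphD -[2]/(2%:~R) ler_int sum_sqr_ge2//; lia.
move: (i%:~R) (j%:~R) n2 => a b; set n := a * a + b * b => n2.
have -> : (a + 1) * (a + 1) + b * b - 1 = n + 2 * a by rewrite /n; ring.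
have -> : (a - 1) * (a - 1) + b * b - 1 = n - 2 * a by rewrite /n; ring.
have -> : a * a + (b + 1) * (b + 1) - 1 = n + 2 * b by rewrite /n; ring.
have -> : a * a + (b - 1) * (b - 1) - 1 = n - 2 * b by rewrite /n; ring.
have ab : 4 * (a * a) * (b * b) <= n * n.
  by have := sqr_ge0 (a * a - b * b); rewrite /n expr2; lra.
have key (c : R) : 0 < c -> c * (n + 2 * a) * (c * (n - 2 * a)) *
    (c * (n + 2 * b) * (c * (n - 2 * b))) <= (c * (n - 1)) ^+ 4.
  move=> c0.
  have -> : c * (n + 2 * a) * (c * (n - 2 * a)) * (c * (n + 2 * b) * (c * (n - 2 * b)))
     = c ^+ 4 * (n * n * (n * n) - 4 * (n * n) * n + 4 * (4 * (a * a) * (b * b))).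
    by rewrite /n; ring.
  rewrite exprMn ler_pM2l ?exprn_gt0//.
  have -> : (n - 1) ^+ 4 = n * n * (n * n) - 4 * (n * n) * n + 6 * (n * n) - 4 * n + 1 by ring.
  have : 0 <= (n - 2) * n by rewrite mulr_ge0; lra.
  by move: ab; move: (4 * (a * a) * (b * b)) => t; lra.
by apply: key; lra.
Qed.

Definition log_barrier (i j : int) : R := ln (barrier (i * i + j * j)).

Lemma sum_sqr_ge0 (a b : int) : 0 <= a * a + b * b.
Proof. by rewrite addr_ge0// -expr2 sqr_ge0. Qed.

Lemma log_barrier_ge0 i j : 0 <= log_barrier i j.
Proof. by rewrite ln_ge0// barrier_ge1// sum_sqr_ge0. Qed.

Lemma log_barrier_superharmonic i j : (i != 0) || (j != 0) ->
  (log_barrier (i + 1) j + log_barrier (i - 1) j + log_barrier i (j + 1) +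
   log_barrier i (j - 1)) / 4 <= log_barrier i j.
Proof.
move=> /(barrier_superharmonic barrier0 barrier1 barrierE).
have pos a b : barrier (a * a + b * b) \is Num.pos.
  by rewrite posrE (lt_le_trans _ (barrier_ge1 (sum_sqr_ge0 a b))).
have posM (x y : R) : x \is Num.pos -> y \is Num.pos -> x * y \is Num.pos by exact: rpredM.
rewrite -ler_ln ?posM ?rpredX// lnXn -?posrE// -mulr_natr /log_barrier.
by rewrite lnM ?posM// lnM// lnM//; lra.
Qed.

Lemma log_barrier_large (A : R) : exists K : nat, forall i j : int,
  (K < `|i|)%N || (K < `|j|)%N -> A < log_barrier i j.
Proof.
pose K := (`|Num.ceil (expR A)| + 2)%N.
have AK : A < ln (K%:R : R).
  have K0 : 0 < K%:R :> R by rewrite ltr0n /K addn2.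
  rewrite -[A]expRK ltr_ln ?posrE ?expR_gt0// /K natrD.
  have h0 : 0 <= Num.ceil (expR A) by rewrite -(ler_int R) (le_trans _ (ceil_ge _))// expR_ge0.
  by have := ceil_ge (expR A); rewrite natr_absz ger0_norm//; lra.
have K2 : (2 <= K)%N by rewrite /K leq_addl.
exists K => i j h; apply: lt_le_trans AK _.
have hn : K%:Z <= i * i + j * j - 1.
  clear -h K2; have le_sqr (c : int) : (K < `|c|)%N -> K%:Z + 1 <= c * c.
    by move=> hc; have [h0|h0] := leP 0 c; nia.
  have := sum_sqr_ge0 i 0; have := sum_sqr_ge0 0 j.
  by case/orP: h => /le_sqr; lia.
have n2 : 2 <= i * i + j * j by lia.
rewrite ler_ln ?posrE ?ltr0n//; last 2 first.
- by rewrite (leq_trans _ K2).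
- by rewrite (lt_le_trans _ (barrier_ge1 (sum_sqr_ge0 i j))).
rewrite barrierE// -[1]/(1%:~R) -intrB.
have : K%:R <= (i * i + j * j - 1)%:~R :> R by rewrite -[K%:R]/((K%:Z)%:~R) ler_int.
by have := ler0n R K; lra.
Qed.

(** This is recurrence in analytic form. Subtracting a small multiple of the barrier, which tends to
    infinity, yields a maximum inside a box, away from the origin. All neighbours of a maximizer of
    largest norm are maximizers too, and a horizontal one is farther out. *)
Lemma srw_max_principle (f : int -> int -> R) (M : R) :
  (forall i j, f i j <= M) ->
  (forall i j, (i != 0) || (j != 0) ->
     f i j <= (f (i + 1) j + f (i - 1) j + f i (j + 1) + f i (j - 1)) / 4) ->
  forall i j, f i j <= f 0 0.
Proof.
move=> fM fsub i1 j1; rewrite leNgt; apply/negP => lt1.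
(* Small enough for [phi] to keep more than half of the gap at [(i1, j1)]. *)
pose eps := (f i1 j1 - f 0 0) / (2 * (log_barrier i1 j1 + 1)).
have g1 := log_barrier_ge0 i1 j1.
have eps0 : 0 < eps by rewrite divr_gt0 ?subr_gt0 ?mulr_gt0 ?ltr_pwDr.
pose phi i j := f i j - eps * log_barrier i j.
have phi0 : phi 0 0 = f 0 0 by rewrite /phi /log_barrier mulr0 addr0 barrier0 ln1 mulr0 subr0.
have phi1 : f 0 0 < phi i1 j1.
  have : eps * (2 * (log_barrier i1 j1 + 1)) = f i1 j1 - f 0 0.
    by rewrite /eps divfK// mulf_neq0// gt_eqF// ltr_pwDr.
  rewrite /phi; nra.
have phisub i j : (i != 0) || (j != 0) ->
    phi i j <= (phi (i + 1) j + phi (i - 1) j + phi i (j + 1) + phi i (j - 1)) / 4.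
  move=> h; have h1 := fsub i j h; have h2 := log_barrier_superharmonic h.
  have : eps * ((log_barrier (i + 1) j + log_barrier (i - 1) j + log_barrier i (j + 1) +
   log_barrier i (j - 1)) / 4) <= eps * log_barrier i j by rewrite ler_pM2l.
  rewrite /phi; lra.
have [K hK] := log_barrier_large ((M - phi i1 j1) / eps).
have out i j : phi i1 j1 <= phi i j -> (`|i| <= K)%N && (`|j| <= K)%N.
  move=> h; rewrite (leqNgt `|i|) (leqNgt `|j|) -negb_or; apply/negP => /hK.
  rewrite ltr_pdivrMr// => h'; have := fM i j; move: h h'; rewrite {2}/phi.
  by move: (phi i1 j1) => t; lra.
pose crd (a : 'I_K.*2.+1) : int := Posz a - Posz K.
have crdP i : (`|i| <= K)%N -> exists a, i = crd a.
  by move=> h; exists (inord (absz (i + K%:Z))); rewrite /crd inordK; lia.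
pose psi (p : 'I_K.*2.+1 * 'I_K.*2.+1) := phi (crd p.1) (crd p.2).
have boxP i j : phi i1 j1 <= phi i j -> exists p, phi i j = psi p /\ (i = crd p.1 /\ j = crd p.2).
  by move=> /out/andP[/crdP[a ->] /crdP[b ->]]; exists (a, b).
have [p1 [e1 _]] := boxP i1 j1 (lexx _).
case: (@arg_maxP _ _ _ p1 predT psi isT) => pm _ pmax.
have le_pm i j : phi i j <= psi pm.
  have [h|h] := leP (phi i1 j1) (phi i j).
    by have [p [-> _]] := boxP i j h; exact: pmax.
  by apply: le_trans (ltW h) _; rewrite e1; exact: pmax.
pose nrm (p : 'I_K.*2.+1 * 'I_K.*2.+1) : nat := (`|crd p.1| ^ 2 + `|crd p.2| ^ 2)%N.
have [pz /eqP pzm pzmax] := @arg_maxnP _ pm (fun p => psi p == psi pm) nrm (eqxx _).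
set i := crd pz.1; set j := crd pz.2.
have phiij : phi i j = psi pm by rewrite -pzm.
have n0 : (i != 0) || (j != 0).
  rewrite -negb_and; apply/negP => /andP[/eqP i0 /eqP j0].
  by have := le_pm i1 j1; rewrite -phiij i0 j0 phi0; lra.
have := phisub i j n0; rewrite phiij => hsub.
have l1 := le_pm (i + 1) j; have l2 := le_pm (i - 1) j.
have l3 := le_pm i (j + 1); have l4 := le_pm i (j - 1).
have farther i' : phi i' j = psi pm -> (`|i'| ^ 2 <= `|i| ^ 2)%N.
  move=> e; have [|p [ep [ei' ej]]] := boxP i' j; first by rewrite e le_pm.
  have := pzmax p; rewrite -ep e eqxx => /(_ isT).
  by rewrite /nrm /= -ei' -ej -/i -/j leq_add2r.
have := farther (i + 1); have := farther (i - 1).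
have -> : phi (i - 1) j = psi pm by lra.
have -> : phi (i + 1) j = psi pm by lra.
by move=> /(_ erefl) h1 /(_ erefl) h2; nia.
Qed.

End RecurrentPlane.

(** * A robot with one stone that covers Z^4 *)

Definition mode : finType := (bool + bool + bool + bool * bool)%type.

(* The flag of a state tells along which of the first two axes the stone was
   moved last; the other booleans are the sign of the move and, for an
   excursion, the axis of the move. *)
Definition state4 : finType := (bool * mode)%type.

Definition carry_st (al sg : bool) : state4 := (al, inl (inl (inl sg))).
Definition start_st (al sg : bool) : state4 := (al, inl (inl (inr sg))).
Definition back_st (al sg : bool) : state4 := (al, inl (inr sg)).
Definition exc_st (al be sg : bool) : state4 := (al, inr (be, sg)).

Definition signed_unit (i : 'I_4) (sg : bool) : cell 4 :=
  if sg then unit_cell i else - unit_cell i.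

Definition move4 (q : state4) : cell 4 :=
  match q with
  | (al, inl (inl (inl sg))) => signed_unit (if al then @Ordinal 4 1 isT else @Ordinal 4 0 isT) sg
  | (_, inl (inl (inr sg))) => signed_unit (@Ordinal 4 2 isT) sg
  | (_, inl (inr sg)) => signed_unit (@Ordinal 4 2 isT) sg
  | (_, inr (be, sg)) => signed_unit (if be then @Ordinal 4 3 isT else @Ordinal 4 2 isT) sg
  end.

Definition carry4 (q : state4) : 1.-tuple bool :=
  [tuple if q.2 is inl (inl (inl _)) then true else false].

(* The stone is seen before the move, so an excursion that comes back to the
   stone overshoots by one step, which [back_st] undoes. *)
Definition trans4 (q : state4) (obs : (1 + 2).-tuple bool) : state4 :=
  let see := nth false obs 0 in let b := nth false obs 2 in
  match q with
  | (al, inl (inl (inl _))) => start_st al b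
  | (al, inl (inl (inr _))) => exc_st al true b
  | (al, inl (inr _)) => carry_st (~~ al) b
  | (al, inr (be, sg)) => if see then back_st al (~~ sg) else exc_st al (~~ be) b
  end.

Lemma move4_direction q : is_direction (move4 q).
Proof.
have dir i sg : is_direction (signed_unit i sg).
  by apply/existsP; exists i; case: sg; rewrite /signed_unit eqxx ?orbT.
by case: q => al [[[sg|sg]|sg]|[be sg]]; exact: dir.
Qed.

Definition robot4 : robot 4 1 := @Robot 4 1 state4 (carry_st false true) trans4 move4 carry4 move4_direction.

Definition vec4 (a b c d : int) : cell 4 := \row_i nth 0 [:: a; b; c; d] i.

Lemma vec4D a b c d a' b' c' d' :
  vec4 a b c d + vec4 a' b' c' d' = vec4 (a + a') (b + b') (c + c') (d + d').
Proof. by apply/rowP => i; rewrite !mxE; case: i => [[|[|[|[|]]]]]. Qed.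

Lemma vec4_inj a b c d a' b' c' d' : vec4 a b c d = vec4 a' b' c' d' ->
  [/\ a = a', b = b', c = c' & d = d'].
Proof.
move=> /rowP h; have := h (@Ordinal 4 0 isT); have := h (@Ordinal 4 1 isT).
by have := h (@Ordinal 4 2 isT); have := h (@Ordinal 4 3 isT); rewrite !mxE.
Qed.

Lemma vec40 : vec4 0 0 0 0 = 0.
Proof. by apply/rowP => i; rewrite !mxE; case: i => [[|[|[|[|]]]]]. Qed.

Lemma vec4_eq0 c d : (vec4 0 0 c d == 0) = (c == 0) && (d == 0).
Proof.
apply/eqP/andP => [|[/eqP -> /eqP ->]]; last exact: vec40.
by rewrite -vec40 => /vec4_inj[_ _ -> ->].
Qed.

Lemma vec4_surj (x : cell 4) : exists a b c d, x = vec4 a b c d.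
Proof.
exists (x 0 (@Ordinal 4 0 isT)), (x 0 (@Ordinal 4 1 isT)).
exists (x 0 (@Ordinal 4 2 isT)), (x 0 (@Ordinal 4 3 isT)).
apply/rowP => i; rewrite mxE.
by case: i => [[|[|[|[|]]]] hi] //=; congr (x 0 _); apply: val_inj.
Qed.

Definition sgz_of (sg : bool) : int := if sg then 1 else -1.

Lemma signed_unitE i sg : signed_unit i sg =
  vec4 (if i == 0 :> nat then sgz_of sg else 0) (if i == 1%N :> nat then sgz_of sg else 0)
       (if i == 2 :> nat then sgz_of sg else 0) (if i == 3 :> nat then sgz_of sg else 0).
Proof.
apply/rowP => j; rewrite /signed_unit; case: i => [[|[|[|[|]]]] hi] //;
  case: j => [[|[|[|[|]]]] hj] //; by case: sg; rewrite !mxE.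
Qed.

Section Cover4.
Context {R : realType}.
Variable x : cell 4.

Definition miss (s y : cell 4) (q : state4) : R := 1 - @cover_prob 4 robot4 R x (s, y, q).

Lemma miss_ge0 s y q : 0 <= miss s y q.
Proof. by rewrite subr_ge0 vlim_le1// => c; exact: one01. Qed.

Lemma miss_le1 s y q : miss s y q <= 1.
Proof. by rewrite lerBlDr lerDl vlim_ge0// => c; exact: one01. Qed.

Lemma miss_target s y q : s + y = x -> miss s y q = 0.
Proof.
move=> h; rewrite /miss /cover_prob vlim_stop ?subrr//; first by move=> c; exact: one01.
by rewrite /hits /= h.
Qed.

(** An equality off the target, and trivial at it, where [miss] vanishes. So [miss] is subharmonic
    everywhere, as the maximum principle requires. *)
Lemma miss_step s y q : miss s y q <=
  let d := @carried 4 robot4 y q in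
  (miss (s + d) (y + (move4 q - d)) (@see_trans 4 robot4 q (y == 0) false) +
   miss (s + d) (y + (move4 q - d)) (@see_trans 4 robot4 q (y == 0) true)) / 2.
Proof.
have [h|h] := boolP (@hits 4 robot4 x (s, y, q)).
  rewrite miss_target; last by move/eqP: h.
  by rewrite divr_ge0// addr_ge0// miss_ge0.
rewrite {1}/miss /cover_prob vlim_step//; last by move=> c; exact: one01.
by rewrite /avg /miss /cover_prob /=; lra.
Qed.

(** The sign kept in the state is a fresh random bit; averaging it out leaves functions of positions
    and axes. *)
Definition mcarry al a b : R :=
  (miss (vec4 a b 0 0) 0 (carry_st al false) + miss (vec4 a b 0 0) 0 (carry_st al true)) / 2.
Definition mstart al a b : R :=
  (miss (vec4 a b 0 0) 0 (start_st al false) + miss (vec4 a b 0 0) 0 (start_st al true)) / 2.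
Definition mexc be al a b c d : R :=
  (miss (vec4 a b 0 0) (vec4 0 0 c d) (exc_st al be false) +
   miss (vec4 a b 0 0) (vec4 0 0 c d) (exc_st al be true)) / 2.

Lemma see_trans4 q see b : @see_trans 4 robot4 q see b =
  match q with
  | (al, inl (inl (inl _))) => start_st al b
  | (al, inl (inl (inr _))) => exc_st al true b
  | (al, inl (inr _)) => carry_st (~~ al) b
  | (al, inr (be, sg)) => if see then back_st al (~~ sg) else exc_st al (~~ be) b
  end.
Proof. by []. Qed.

Lemma carried4 y q : @carried 4 robot4 y q =
  if (y == 0) && (if q.2 is inl (inl (inl _)) then true else false) then move4 q else 0.
Proof. by []. Qed.

Lemma miss_carry al sg a b : miss (vec4 a b 0 0) 0 (carry_st al sg) <=
  mstart al (a + if al then 0 else sgz_of sg) (b + if al then sgz_of sg else 0).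
Proof.
apply: le_trans (miss_step _ _ _) _; rewrite !carried4 !see_trans4 eqxx /= subrr addr0.
by rewrite signed_unitE vec4D; case: al.
Qed.

Lemma miss_start al sg a b : miss (vec4 a b 0 0) 0 (start_st al sg) <=
  mexc true al a b (sgz_of sg) 0.
Proof.
apply: le_trans (miss_step _ _ _) _; rewrite !carried4 !see_trans4 eqxx /= subr0 addr0 add0r.
by rewrite signed_unitE.
Qed.

Lemma miss_back al sg a b : miss (vec4 a b 0 0) (vec4 0 0 (- sgz_of sg) 0) (back_st al sg) <=
  mcarry (~~ al) a b.
Proof.
apply: le_trans (miss_step _ _ _) _; rewrite !carried4 !see_trans4 andbF /= subr0 addr0.
by rewrite signed_unitE vec4D /= !addr0 addNr vec40.
Qed.

Lemma miss_exc_stone al sg a b : miss (vec4 a b 0 0) 0 (exc_st al false sg) <= mcarry (~~ al) a b.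
Proof.
apply: le_trans (miss_step _ _ _) _; rewrite !carried4 !see_trans4 eqxx /= subr0 addr0 add0r.
rewrite signed_unitE /=; have := miss_back al (~~ sg) a b.
have -> : - sgz_of (~~ sg) = sgz_of sg by case: sg.
lra.
Qed.

Lemma miss_exc al be sg a b c d : (c != 0) || (d != 0) ->
  miss (vec4 a b 0 0) (vec4 0 0 c d) (exc_st al be sg) <=
  mexc (~~ be) al a b (c + if be then 0 else sgz_of sg) (d + if be then sgz_of sg else 0).
Proof.
move=> h; have y0 : (vec4 0 0 c d == 0) = false.
  by rewrite vec4_eq0; apply/negbTE; rewrite negb_and.
apply: le_trans (miss_step _ _ _) _; rewrite !carried4 !see_trans4 y0 /= subr0 addr0.
by rewrite signed_unitE vec4D; case: be.
Qed.

Lemma mcarry_le al a b : mcarry al a b <=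
  (mstart al (a + if al then 0 else 1) (b + if al then 1 else 0) +
   mstart al (a - if al then 0 else 1) (b - if al then 1 else 0)) / 2.
Proof.
have h1 := miss_carry al true a b; have h2 := miss_carry al false a b.
by rewrite /mcarry; move: h1 h2; case: al; rewrite /= ?oppr0; lra.
Qed.

Lemma mstart_le al a b : mstart al a b <=
  (mexc true al a b 1 0 + mexc true al a b (-1) 0) / 2.
Proof.
by rewrite /mstart; have := miss_start al true a b; have := miss_start al false a b; rewrite /=; lra.
Qed.

Lemma mexc_stone al a b : mexc false al a b 0 0 <= mcarry (~~ al) a b.
Proof.
rewrite /mexc vec40.
by have := miss_exc_stone al true a b; have := miss_exc_stone al false a b; lra.
Qed.

Lemma mexc_false_le al a b c d : (c != 0) || (d != 0) ->
  mexc false al a b c d <= (mexc true al a b (c + 1) d + mexc true al a b (c - 1) d) / 2.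
Proof.
move=> h; have := miss_exc al false true a b h; have := miss_exc al false false a b h.
by rewrite /= !addr0 {3}/mexc; lra.
Qed.

Lemma mexc_true_le al a b c d : (c != 0) || (d != 0) ->
  mexc true al a b c d <= (mexc false al a b c (d + 1) + mexc false al a b c (d - 1)) / 2.
Proof.
move=> h; have := miss_exc al true true a b h; have := miss_exc al true false a b h.
by rewrite /= !addr0 {3}/mexc; lra.
Qed.
End Cover4.

(** * The maximum principle applied to the stone and to the excursions *)

Section Cover4Proof.
Context {R : realType}.
Variables x0 x1 x2 x3 : int.
Local Notation x := (vec4 x0 x1 x2 x3).
Local Notation mcarry := (@mcarry R x).
Local Notation mstart := (@mstart R x).
Local Notation mexc := (@mexc R x).

Lemma mean_le1 s y q q' : (@miss R x s y q + @miss R x s y q') / 2 <= 1.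
Proof. by have := @miss_le1 R x s y q; have := @miss_le1 R x s y q'; lra. Qed.

(** Two steps along alternating axes make a diagonal step, which preserves the parity of the
    coordinate sum. The coordinates i+j and i-j around the pole turn diagonal steps into simple
    random walk on one parity class. *)
Lemma plane_shift (f : int -> int -> R) (c0 d0 : int) (M : R) :
  (forall c d, f c d <= M) ->
  (forall c d k, c + d = c0 + d0 + 2 * k -> (c != c0) || (d != d0) ->
    f c d <= (f (c + 1) (d + 1) + f (c + 1) (d - 1) + f (c - 1) (d + 1) + f (c - 1) (d - 1)) / 4) ->
  forall c d k, c + d = c0 + d0 + 2 * k -> f c d <= f c0 d0.
Proof.
move=> fM fsub c d k e.
pose F i j := f (c0 + (i + j)) (d0 + (i - j)).
have := @srw_max_principle R F M; rewrite /F => h.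
have {}h := h (fun i j => fM _ _) _ k (c - c0 - k).
have -> : c = c0 + (k + (c - c0 - k)) by ring.
have -> : d = d0 + (k - (c - c0 - k)) by lia.
have e00 : f c0 d0 = f (c0 + (0 + 0)) (d0 + (0 - 0)) by rewrite subr0 !addr0.
rewrite e00; apply: h => i j nz.
have := fsub (c0 + (i + j)) (d0 + (i - j)) i.
have -> : c0 + (i + j) + (d0 + (i - j)) = c0 + d0 + 2 * i by ring.
move=> /(_ erefl).
have -> : (c0 + (i + j) != c0) || (d0 + (i - j) != d0) by lia.
move=> /(_ isT).
have -> : c0 + (i + j) + 1 = c0 + (i + 1 + j) by ring.
have -> : d0 + (i - j) + 1 = d0 + (i + 1 - j) by ring.
have -> : c0 + (i + j) - 1 = c0 + (i - 1 + j) by ring.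
have -> : d0 + (i - j) - 1 = d0 + (i - 1 - j) by ring.
have -> : c0 + (i + (j + 1)) = c0 + (i + 1 + j) by ring.
have -> : d0 + (i - (j + 1)) = d0 + (i - 1 - j) by ring.
have -> : c0 + (i + (j - 1)) = c0 + (i - 1 + j) by ring.
have -> : d0 + (i - (j - 1)) = d0 + (i + 1 - j) by ring.
lra.
Qed.

Lemma mexc_sub al a b c d k : c + d = 2 * k -> (c != 0) || (d != 0) ->
  mexc false al a b c d <=
  (mexc false al a b (c + 1) (d + 1) + mexc false al a b (c + 1) (d - 1) +
   mexc false al a b (c - 1) (d + 1) + mexc false al a b (c - 1) (d - 1)) / 4.
Proof.
move=> e h; have h0 := @mexc_false_le R x al a b _ _ h.
have n1 : (c + 1 != 0) || (d != 0) by clear -e; lia.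
have n2 : (c - 1 != 0) || (d != 0) by clear -e; lia.
have := @mexc_true_le R x al a b _ _ n1; have := @mexc_true_le R x al a b _ _ n2; lra.
Qed.

Lemma mstart_sub al a b : mstart al a b <=
  (mexc false al a b 1 1 + mexc false al a b 1 (-1) +
   mexc false al a b (-1) 1 + mexc false al a b (-1) (-1)) / 4.
Proof.
have := @mstart_le R x al a b.
have := @mexc_true_le R x al a b 1 0 isT; have := @mexc_true_le R x al a b (-1) 0 isT.
rewrite !add0r; lra.
Qed.

(* The excursion comes back to the stone by recurrence of the plane walk. *)
Lemma mstart_le_mcarry al a b : mstart al a b <= mcarry (~~ al) a b.
Proof.
have ub c d : mexc false al a b c d <= mexc false al a b 0 0 \/ forall k, c + d != 2 * k.
  have [[k e]|n] := pselect (exists k, c + d = 2 * k); last first.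
    by right=> k; apply/eqP => e; apply: n; exists k.
  left; apply: (@plane_shift (fun c d => mexc false al a b c d) 0 0 1 _ _ _ _ k).
  - by move=> *; exact: mean_le1.
  - by move=> c' d' k' e'; apply: (@mexc_sub _ _ _ _ _ k'); rewrite e' !add0r.
  - by rewrite e !add0r.
have even k c d : c + d = 2 * k -> mexc false al a b c d <= mcarry (~~ al) a b.
  move=> e; apply: le_trans (@mexc_stone R x al a b).
  by case: (ub c d) => // /(_ k); rewrite e eqxx.
apply: le_trans (mstart_sub al a b) _.
have h1 := @even 1 1 1 erefl; have h2 := @even 0 1 (-1) erefl.
have h3 := @even 0 (-1) 1 erefl; have h4 := @even (-1) (-1) (-1) erefl; lra.
Qed.

(** [mcarry al] is subharmonic at the pole as well, so any point of the class can be the pole and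
    the function is constant on it, as in Liouville's theorem. *)
Lemma mcarry_class al a b a' b' k : a + b = a' + b' + 2 * k ->
  mcarry al a b <= mcarry al a' b'.
Proof.
move=> e; apply: (@plane_shift (fun a b => mcarry al a b) a' b' 1 _ _ _ _ k e).
  by move=> *; exact: mean_le1.
move=> c d _ _ _.
have s1 al' u v := @mstart_le_mcarry al' u v; have c1 := @mcarry_le R x al c d.
case: al e c1 => e /=; rewrite !addr0 ?subr0 => c1.
  have := s1 true c (d + 1); have := s1 true c (d - 1).
  have := @mcarry_le R x false c (d + 1); have := @mcarry_le R x false c (d - 1).
  rewrite /= !addr0 ?subr0.
  have := s1 false (c + 1) (d + 1); have := s1 false (c - 1) (d + 1).
  have := s1 false (c + 1) (d - 1); have := s1 false (c - 1) (d - 1).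
  rewrite /=; lra.
have := s1 false (c + 1) d; have := s1 false (c - 1) d.
have := @mcarry_le R x true (c + 1) d; have := @mcarry_le R x true (c - 1) d.
rewrite /= !addr0 ?subr0.
have := s1 true (c + 1) (d + 1); have := s1 true (c - 1) (d + 1).
have := s1 true (c + 1) (d - 1); have := s1 true (c - 1) (d - 1).
rewrite /=; lra.
Qed.

(** From the initial configuration, the stone is carried along the second axis from odd positions
    and along the first one from even positions; [kappa] belongs to this parity pattern. *)
Let kappa : R := mcarry true 1 0.

Lemma mcarry_odd a b k : a + b = 2 * k + 1 -> mcarry true a b <= kappa.
Proof. by move=> e; apply: (@mcarry_class _ _ _ _ _ k); rewrite e; ring. Qed.

Lemma mcarry_even a b k : a + b = 2 * k -> mcarry false a b <= kappa.
Proof.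
move=> e; apply: le_trans (@mcarry_le R x false a b) _; rewrite /= !addr0 ?subr0.
have h1 := @mstart_le_mcarry false (a + 1) b; have h2 := @mstart_le_mcarry false (a - 1) b.
have h3 : mcarry true (a + 1) b <= kappa by apply: (@mcarry_odd _ _ k); clear -e; lia.
have h4 : mcarry true (a - 1) b <= kappa by apply: (@mcarry_odd _ _ (k - 1)); clear -e; lia.
rewrite /= in h1 h2; lra.
Qed.

(* The stone comes to the plane of the target, and the mean value property of
   the constant [kappa] leaves no loss there. *)
Lemma stone_in_target_plane : exists al,
  kappa <= mstart al x0 x1 /\ mcarry (~~ al) x0 x1 <= kappa.
Proof.
have [[k e]|[k e]] : (exists k, x0 + x1 = 2 * k) \/ (exists k, x0 + x1 = 2 * k + 1).
- have h : ((x0 + x1 = 2 * ((x0 + x1) %/ 2)%Z) \/ (x0 + x1 = 2 * ((x0 + x1) %/ 2)%Z + 1)) by lia.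
  by case: h => h; [left|right]; exists ((x0 + x1) %/ 2)%Z.
- exists true; split; last exact: mcarry_even e.
  have h0 : kappa <= mcarry true x0 (x1 + 1).
    by apply: (@mcarry_class _ _ _ _ _ (- k)); clear -e; lia.
  have h1 := @mcarry_le R x true x0 (x1 + 1).
  have h2 := @mstart_le_mcarry true x0 (x1 + 1 + 1).
  have h3 : mcarry false x0 (x1 + 1 + 1) <= kappa by apply: (@mcarry_even _ _ (k + 1)); clear -e; lia.
  by move: h1 h2; rewrite /= !addr0 ?subr0 addrK; lra.
exists false; split; last exact: mcarry_odd e.
have h0 : kappa <= mcarry false (x0 + 1) x1.
  have c1 := @mcarry_le R x true 1 0.
  have h1 := @mstart_le_mcarry true 1 1; have h2 := @mstart_le_mcarry true 1 (-1).
  have h3 : mcarry false 1 1 <= mcarry false (x0 + 1) x1.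
    by apply: (@mcarry_class _ _ _ _ _ (- k)); clear -e; lia.
  have h4 : mcarry false 1 (-1) <= mcarry false (x0 + 1) x1.
    by apply: (@mcarry_class _ _ _ _ _ (- k - 1)); clear -e; lia.
  by move: c1 h1 h2; rewrite /kappa /= !addr0 ?subr0 !add0r; lra.
have h1 := @mcarry_le R x false (x0 + 1) x1.
have h2 := @mstart_le_mcarry false (x0 + 1 + 1) x1.
have h3 : mcarry true (x0 + 1 + 1) x1 <= kappa by apply: (@mcarry_odd _ _ (k + 1)); clear -e; lia.
by move: h1 h2; rewrite /= !addr0 ?subr0 addrK; lra.
Qed.

(** With the value at the stone raised to [kappa], the excursion function [f] in the target plane is
    subharmonic at the stone too, so the target, where the value is 0, can be the pole. A target of
    odd parity is met halfway through a diagonal step, and [E true] takes the place of [f]. *)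
Lemma kappa_le0 : kappa <= 0.
Proof.
have [al [hstart hcarry]] := stone_in_target_plane.
pose E be c d := mexc be al x0 x1 c d.
have target be : E be x2 x3 = 0.
  by rewrite /E /mexc !miss_target ?addr0 ?mul0r// vec4D !addr0 !add0r.
pose f c d := if (c == 0) && (d == 0) then kappa else E false c d.
have fE c d : E false c d <= f c d.
  rewrite /f; case: ifP => // /andP[/eqP -> /eqP ->].
  by apply: le_trans hcarry; exact: mexc_stone.
have f0 : f 0 0 = kappa by [].
have A c d : f c d <= (E true (c + 1) d + E true (c - 1) d) / 2.
  rewrite /f; case: ifPn => [/andP[/eqP -> /eqP ->]|nz].
    by apply: le_trans hstart _; rewrite !add0r; exact: mstart_le.
  by apply: mexc_false_le; rewrite -negb_and.
have B c d : (c != 0) || (d != 0) -> E true c d <= (f c (d + 1) + f c (d - 1)) / 2.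
  by move=> /(@mexc_true_le R x al x0 x1); have := fE c (d + 1); have := fE c (d - 1); rewrite /E; lra.
have E1 be c d : E be c d <= 1 by exact: mean_le1.
have f1 c d : f c d <= 1 by rewrite /f; case: ifP => // _; exact: mean_le1.
have [[k e]|[k e]] : (exists k, x2 + x3 = 2 * k) \/ (exists k, x2 + x3 = 2 * k + 1).
- have h : ((x2 + x3 = 2 * ((x2 + x3) %/ 2)%Z) \/ (x2 + x3 = 2 * ((x2 + x3) %/ 2)%Z + 1)) by lia.
  by case: h => h; [left|right]; exists ((x2 + x3) %/ 2)%Z.
- have [/andP[/eqP z2 /eqP z3]|nz] := boolP ((x2 == 0) && (x3 == 0)).
    apply: le_trans hstart _; rewrite /mstart !miss_target ?addr0 ?mul0r//.
      by rewrite z2 z3 ?addr0.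
    by rewrite z2 z3 ?addr0.
  rewrite -f0 -(target false).
  have -> : E false x2 x3 = f x2 x3 by rewrite /f (negbTE nz).
  apply: (@plane_shift f x2 x3 1 f1 _ 0 0 (- k)); last by clear -e; lia.
  move=> c d k' e' _; have := A c d.
  have n1 : (c + 1 != 0) || (d != 0) by clear -e e'; lia.
  have n2 : (c - 1 != 0) || (d != 0) by clear -e e'; lia.
  by have := B _ _ n1; have := B _ _ n2; lra.
have odd_le c d k' : c + d = x2 + x3 + 2 * k' -> E true c d <= 0.
  move=> e'; rewrite -(target true); apply: (@plane_shift (E true) x2 x3 1 (E1 true) _ _ _ k' e').
  move=> c' d' k2 ek _.
  have nz : (c' != 0) || (d' != 0) by clear -e ek; lia.
  by have := B c' d' nz; have := A c' (d' + 1); have := A c' (d' - 1); lra.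
rewrite -f0; apply: le_trans (A 0 0) _; rewrite !add0r.
have h1 : E true 1 0 <= 0 by apply: (@odd_le _ _ (- k)); clear -e; lia.
have h2 : E true (-1) 0 <= 0 by apply: (@odd_le _ _ (- k - 1)); clear -e; lia.
lra.
Qed.

Lemma robot4_cover_prob : @cover_prob 4 robot4 R x (0, 0, init_state robot4) = 1.
Proof.
have h0 := @miss_carry R x false true 0 0; rewrite vec40 /= !add0r in h0.
have h1 := @mstart_le_mcarry false 1 0; rewrite /= in h1.
have h2 := kappa_le0; rewrite /kappa in h2.
have : @miss R x 0 0 (carry_st false true) <= 0 by lra.
have := @miss_ge0 R x 0 0 (carry_st false true).
by rewrite /miss /=; lra.
Qed.

End Cover4Proof.

Theorem mainTheorem2 (R : realType) :
  (exists r : robot 4 1, covers R r set0) /\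
  ~ (exists r : robot 5 1, covers R r set0).
Proof.
split.
  exists robot4; apply/covers1P => x; have [a [b [c [d ->]]]] := vec4_surj x.
  exact: robot4_cover_prob.
by move=> [r /covers1P]; exact: not_cover5.
Qed.
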